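(* Let $\Omega\subset\mathbb{R}^n$ be a bounded domain. Then the following are equivalent: (1) $\Omega$ is a QH-visibility domain. (2) For every pair of points $p,q\in\partial_{Euc}\Omega$ with $p\neq q$, and all sequences $\{z_k\},\{w_k\}\subset\Omega$ with $z_k\to p$ and $w_k\to q$ (in the Euclidean topology), one has $$\limsup_{k\to\infty}(z_k|w_k)_o<\infty$$ for a fixed (hence any) point $o\in\Omega$.
   Context: For a domain $\Omega\subsetneq\mathbb{R}^n$, $\partial_{Euc}\Omega$ is its Euclidean boundary and $\delta_\Omega(x)=d_{Euc}(x,\partial_{Euc}\Omega)$. The quasihyperbolic metric is $k_\Omega(x,y)=\inf_\gamma\int_\gamma\frac{|dx|}{\delta_\Omega(x)}$, the infimum over rectifiable curves in $\Omega$ joining $x$ and $y$; $(\Omega,k_\Omega)$ is a complete, proper, geodesic metric space, and a quasihyperbolic geodesic is a geodesic of $(\Omega,k_\Omega)$. The Gromov product is $(x|y)_o=\frac12\big(k_\Omega(x,o)+k_\Omega(o,y)-k_\Omega(x,y)\big)$. A bounded domain $\Omega$ is a QH-visibility domain if for every pair $p,q\in\partial_{Euc}\Omega$, $p\neq q$, there exist neighborhoods $U$ of $p$ and $V$ of $q$ in $\mathbb{R}^n$ with $\overline U\cap\overline V=\emptyset$ and a compact set $K\subset\Omega$ such that every quasihyperbolic geodesic $\gamma:[0,T]\to\Omega$ with $\gamma(0)\in U$ and $\gamma(T)\in V$ satisfies $\gamma([0,T])\cap K\neq\emptyset$. *)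

(* Defs.v *)
From mathcomp Require Import all_boot all_order all_algebra.
From mathcomp Require Import all_classical all_reals all_analysis.

Set Implicit Arguments.
Unset Strict Implicit.
Unset Printing Implicit Defensive.

Import Order.TTheory GRing.Theory Num.Theory.
Import numFieldNormedType.Exports.

Local Open Scope classical_set_scope.
Local Open Scope ring_scope.

(* R^n is 'rV[R]_n. The library norm on 'rV[R]_n is the sup norm. It gives the
   Euclidean topology and the Euclidean bounded sets, so the library notions of
   open, closed, compact, bounded and convergence are used, but lengths and
   distances must be computed with [enorm]. *)

Section Euclidean.
Variables (R : realType) (n : nat).
Implicit Types (x y p q : 'rV[R]_n) (A Omega : set 'rV[R]_n).

Definition enorm x : R := Num.sqrt (\sum_(i < n) x ord0 i ^+ 2).

Definition boundary A : set 'rV[R]_n := closure A `\` interior A.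

Definition domain Omega : Prop :=
  [/\ open Omega, connected Omega & Omega !=set0].

Definition bounded_domain Omega : Prop := domain Omega /\ bounded_set Omega.

(* When the boundary is empty this is the junk value 0. That cannot happen for
   a bounded domain of R^n with n > 0. *)
Definition boundary_dist Omega x : R :=
  inf [set enorm (x - y) | y in boundary Omega].

End Euclidean.

Section Curves.
Variables (R : realType) (n : nat).
Implicit Types (g : R -> 'rV[R]_n) (a b s t : R) (rho : 'rV[R]_n -> R).

(* As in [variation], [l] lists the points of a subdivision of [a, b] without
   its first point a. *)
Definition polygonal_length g a (l : seq R) : R :=
  \sum_(i < size l) enorm (g (nth a (a :: l) i.+1) - g (nth a (a :: l) i)).

Definition curve_length g a b : \bar R :=
  ereal_sup [set (polygonal_length g a l)%:E | l in itv_partition a b].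

Definition rectifiable_curve g a b : Prop :=
  [/\ a <= b, {within `[a, b], continuous g} & (curve_length g a b < +oo)%E].

(* The arc-length parametrization, from [0, length] to R^n: its value at s is
   the point of the curve at distance s along the curve from g a. This does not
   depend on the choice of t, since g is constant between two parameters with
   the same length. *)
Definition arclength_param g a b s : 'rV[R]_n :=
  g (xget a [set t | t \in `[a, b] /\ curve_length g a t = s%:E]).

Definition line_integral rho g a b : R :=
  \int[@lebesgue_measure R]_(s in `[0, fine (curve_length g a b)])
    rho (arclength_param g a b s).

End Curves.

Section Quasihyperbolic.
Variables (R : realType) (n : nat) (Omega : set 'rV[R]_n).
Implicit Types (x y z w o : 'rV[R]_n) (g : R -> 'rV[R]_n).

Definition curve_joining x y g (a b : R) : Prop :=
  [/\ rectifiable_curve g a b, forall t, t \in `[a, b] -> Omega (g t),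
      g a = x & g b = y].

Definition qh_dist x y : R :=
  inf [set r | exists g a b, curve_joining x y g a b /\
               r = line_integral (fun u => (boundary_dist Omega u)^-1) g a b].

Definition qh_geodesic g (T : R) : Prop :=
  [/\ 0 <= T, forall t, t \in `[0, T] -> Omega (g t) &
      forall s t, s \in `[0, T] -> t \in `[0, T] ->
        qh_dist (g s) (g t) = `|s - t|].

Definition gromov_product o x y : R :=
  (qh_dist x o + qh_dist o y - qh_dist x y) / 2.

Definition qh_visibility_domain : Prop :=
  bounded_domain Omega /\
  forall p q, boundary Omega p -> boundary Omega q -> p <> q ->
  exists U V K : set 'rV[R]_n,
    [/\ nbhs p U, nbhs q V, closure U `&` closure V = set0,
        compact K /\ K `<=` Omega &
        forall (T : R) g, qh_geodesic g T -> U (g 0) -> V (g T) ->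
          exists2 t, t \in `[0, T] & K (g t)].

End Quasihyperbolic.

(* Main.v *)
Require Import Defs.
From mathcomp Require Import all_boot all_order all_algebra.
From mathcomp Require Import all_classical all_reals all_analysis.
From mathcomp Require Import ring lra.

Set Implicit Arguments.
Unset Strict Implicit.
Unset Printing Implicit Defensive.

Import Order.TTheory GRing.Theory Num.Theory.
Import numFieldNormedType.Exports.

Local Open Scope classical_set_scope.
Local Open Scope ring_scope.

(** Write [k] for the quasihyperbolic distance and [delta] for the distance to
    the boundary.

    If [Omega] is a visibility domain, a geodesic from [z] near [p] to [w] near
    [q] meets the compact set [K] at some [u], so that
    [k z w = k z u + k u w >= k z o + k o w - 2 * k o u]; hence the Gromov
    product of [z] and [w] at [o] is at most [k o u], which is bounded for [u]
    in [K] ([visibility_gromov_bounded]).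

    Conversely, finiteness of all upper limits means that Gromov products are
    bounded on a product of neighbourhoods of any two distinct boundary points
    ([gromov_limsup_bounded]). If there were geodesics from points tending to
    [p] to points tending to [q] avoiding larger and larger compact sets, then
    they would cross a fixed sphere around [p] at points that accumulate at some
    [x] of the boundary, different from [p] and [q]. Let [u] be such a crossing
    point, on a geodesic from [z] to [w]. Boundedness near [(p, x)] and
    [(x, q)], together with [k z w = k z u + k u w] and
    [k z w <= k z o + k o w], bounds [k o u], whereas [k o u] tends to infinity
    at the boundary ([gromov_bounded_visibility]).

    What has to be known about [k] is that it is a metric, that it controls the
    Euclidean distance, that its balls are relatively compact in [Omega], and
    that geodesics exist. All of this is read off Lipschitz paths. On the one
    hand the arc-length parametrization of a rectifiable curve is a
    1-Lipschitz path, of cost [int rho(alpha(s)) ds] equal to the line integral,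
    with [rho = 1 / delta] ([arclength_lip_path]); on the other hand the line
    integral along a 1-Lipschitz path is at most this cost
    ([line_integral_le_path_cost]). So [k] is the infimum of the costs of
    1-Lipschitz paths. Properness comes from [delta y <= delta x * exp (k x y)]
    ([boundary_dist_le_expR]), because [delta] grows at most at unit speed along
    a path. Geodesics are pointwise limits, along an ultrafilter, of nearly
    minimal paths parametrized by their cost ([ex_qh_geodesic]). *)

(** * The Euclidean norm *)

Section EuclideanNorm.
Context {R : realType} {n : nat}.
Implicit Types x y z : 'rV[R]_n.

Lemma enorm_ge0 x : 0 <= enorm x.
Proof. exact: sqrtr_ge0. Qed.

Lemma sqr_enorm x : enorm x ^+ 2 = \sum_(i < n) x ord0 i ^+ 2.
Proof. by rewrite sqr_sqrtr// sumr_ge0// => i _; rewrite sqr_ge0. Qed.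

Lemma enormZ (c : R) x : enorm (c *: x) = `|c| * enorm x.
Proof.
rewrite /enorm -sqrtr_sqr -sqrtrM ?sqr_ge0// mulr_sumr.
by under eq_bigr do rewrite mxE exprMn.
Qed.

Lemma enorm0 : enorm (0 : 'rV[R]_n) = 0.
Proof. by rewrite -(scale0r 0) enormZ normr0 mul0r. Qed.

Lemma enormN x : enorm (- x) = enorm x.
Proof. by rewrite -scaleN1r enormZ normrN1 mul1r. Qed.

Lemma enormB x y : enorm (x - y) = enorm (y - x).
Proof. by rewrite -enormN opprB. Qed.

Lemma ler_norm_enorm x : `|x| <= enorm x.
Proof.
rewrite [leLHS]/Num.norm /= mx_normrE; apply/bigmax_leP; split=> [|[i j] _ /=].
  exact: enorm_ge0.
rewrite (ord1 i) -(sqrtr_sqr (x ord0 j)) ler_wsqrtr//.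
by rewrite (bigD1 j)//= lerDl sumr_ge0// => k _; rewrite sqr_ge0.
Qed.

Lemma norm_coord_le x (i : 'I_n) : `|x ord0 i| <= `|x|.
Proof.
rewrite [leRHS]/Num.norm /= mx_normrE.
by apply: (le_trans _ (le_bigmax _ _ (ord0, i))).
Qed.

Lemma enorm_eq0 x : enorm x = 0 -> x = 0.
Proof.
by move=> x0; apply/eqP; rewrite -normr_le0 -x0 ler_norm_enorm.
Qed.

(** Cauchy-Schwarz in disguise: with [a] and [b] the two norms, summing
    [2 * x_i * y_i <= (b / a) * x_i ^ 2 + (a / b) * y_i ^ 2] over [i] bounds
    twice the inner product by [2 * a * b]. *)
Lemma ler_enormD x y : enorm (x + y) <= enorm x + enorm y.
Proof.
have [/eqP/enorm_eq0->|x0] := boolP (enorm x == 0).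
  by rewrite add0r lerDr enorm_ge0.
have [/eqP/enorm_eq0->|y0] := boolP (enorm y == 0).
  by rewrite addr0 lerDl enorm_ge0.
have {}x0 : 0 < enorm x by rewrite lt_def x0 enorm_ge0.
have {}y0 : 0 < enorm y by rewrite lt_def y0 enorm_ge0.
rewrite -(@ler_pXn2r _ 2)// ?nnegrE ?addr_ge0 ?enorm_ge0// sqrrD.
set a := enorm x in x0 *; set b := enorm y in y0 *.
have -> : enorm (x + y) ^+ 2 =
    a ^+ 2 + \sum_(i < n) (x ord0 i * y ord0 i *+ 2) + b ^+ 2.
  rewrite !sqr_enorm -!big_split/=; apply: eq_bigr => i _.
  by rewrite mxE sqrrD.
rewrite lerD2r lerD2l.
apply: (@le_trans _ _ (b / a * a ^+ 2 + a / b * b ^+ 2)).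
  rewrite !sqr_enorm !mulr_sumr -big_split/=; apply: ler_sum => i _.
  set u := x _ _; set v := y _ _.
  rewrite -subr_ge0.
  have -> : b / a * u ^+ 2 + a / b * v ^+ 2 - u * v *+ 2 =
     (b * u - a * v) ^+ 2 / (a * b).
    by field; rewrite !gt_eqF.
  by rewrite divr_ge0 ?sqr_ge0// mulr_ge0// ltW.
rewrite le_eqVlt; apply/orP; left; apply/eqP; field.
by rewrite !gt_eqF.
Qed.

Lemma ler_enorm_sum (I : finType) (F : I -> 'rV[R]_n) :
  enorm (\sum_i F i) <= \sum_i enorm (F i).
Proof.
elim/big_rec2: _ => [|i u v _ uv]; first by rewrite enorm0.
by rewrite (le_trans (ler_enormD _ _))// lerD2l.
Qed.

Lemma enorm_le_norm x : enorm x <= n%:R * `|x|.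
Proof.
rewrite [in leLHS](row_sum_delta x) (le_trans (ler_enorm_sum _))//.
rewrite mulr_natl -[X in _ *+ X](card_ord n) -sumr_const; apply: ler_sum => i _.
rewrite enormZ; apply: le_trans (norm_coord_le x i).
rewrite ler_piMr// /enorm (bigD1 i)//= big1 ?addr0 => [|j ji].
  by rewrite mxE !eqxx expr1n sqrtr1.
by rewrite mxE (negbTE ji) andbF expr0n.
Qed.

Lemma enorm_triangle y x z : enorm (x - z) <= enorm (x - y) + enorm (y - z).
Proof.
have -> : x - z = (x - y) + (y - z) by rewrite addrA subrK.
exact: ler_enormD.
Qed.

Lemma ler_dist_enorm x y : `|enorm x - enorm y| <= enorm (x - y).
Proof.
have h (u v : 'rV[R]_n) : enorm u - enorm v <= enorm (u - v).
  by have := ler_enormD (u - v) v; rewrite subrK lerBlDr.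
by rewrite ler_norml h andbT lerNl opprB enormB h.
Qed.

(** Holds because the sup norm, which defines the topology, and the Euclidean
    norm are equivalent. *)
Lemma enorm_lipschitz_continuous (f : 'rV[R]_n -> R) :
  (forall x y, `|f x - f y| <= enorm (x - y)) -> continuous f.
Proof.
move=> fl x; have FF := nbhs_filter x; apply/cvgrPdist_lt => e e0.
have c0 : 0 < e / (n%:R + 1) by rewrite divr_gt0// ltr_wpDl.
have : \forall y \near x, `|x - y| < e / (n%:R + 1).
  by have := nbhsx_ballx x _ c0; rewrite -ball_normE.
apply: filterS => y; rewrite ltr_pdivlMr ?ltr_wpDl// => xy.
rewrite (le_lt_trans (fl _ _))// (le_lt_trans (enorm_le_norm _))//.
by rewrite (le_lt_trans _ xy)// mulrC ler_wpM2l// lerDl.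
Qed.

Lemma enorm_sub_continuous x : continuous (fun y => enorm (y - x)).
Proof.
apply: enorm_lipschitz_continuous => y z.
by rewrite (le_trans (ler_dist_enorm _ _))// opprB addrA subrK.
Qed.

(** The neighbourhoods of ['rV[R]_n] come from the sup norm; this gives access
    to them through [enorm]. *)
Lemma near_enorm x (e : R) : 0 < e -> \forall y \near x, enorm (y - x) < e.
Proof.
move=> e0; have /cvgrPdist_lt/(_ _ e0) := @enorm_sub_continuous x x.
rewrite subrr enorm0; apply: filterS => y.
by rewrite sub0r normrN ger0_norm ?enorm_ge0.
Qed.

End EuclideanNorm.

(** * The distance to the boundary *)

Section BoundaryDistance.
Context {R : realType} {n : nat} (Omega : set 'rV[R]_n).
Hypothesis Omega_open : open Omega.
Hypothesis Omega_bounded : bounded_set Omega.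
Hypothesis boundary_neq0 : boundary Omega !=set0.
Implicit Types x y : 'rV[R]_n.

Local Notation delta := (boundary_dist Omega).

Lemma boundary_openE x : boundary Omega x <-> closure Omega x /\ ~ Omega x.
Proof. by rewrite /boundary (interior_id _).1. Qed.

Let dist_set_has_inf x : has_inf [set enorm (x - y) | y in boundary Omega].
Proof.
split; first by have [p bp] := boundary_neq0; exists (enorm (x - p)), p.
by exists 0 => _ [y _ <-]; exact: enorm_ge0.
Qed.

Lemma boundary_dist_le x y : boundary Omega y -> delta x <= enorm (x - y).
Proof.
by move=> byy; apply: ge_inf; [case: (dist_set_has_inf x)|exists y].
Qed.

Lemma boundary_dist_ge x r : (forall y, boundary Omega y -> r <= enorm (x - y)) ->
  r <= delta x.
Proof.
move=> h; apply: lb_le_inf => [|_ [y byy <-]]; last exact: h.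
by case: (dist_set_has_inf x).
Qed.

Lemma boundary_dist_ge0 x : 0 <= delta x.
Proof. by apply: boundary_dist_ge => y _; exact: enorm_ge0. Qed.

Lemma boundary_dist_boundary x : boundary Omega x -> delta x = 0.
Proof.
move=> bx; apply/eqP; rewrite eq_le boundary_dist_ge0 andbT.
by rewrite (le_trans (boundary_dist_le _ bx))// subrr enorm0.
Qed.

Lemma boundary_dist_lip x y : delta x <= delta y + enorm (x - y).
Proof.
rewrite -lerBlDr; apply: boundary_dist_ge => z bz.
by have := boundary_dist_le x bz; have := enorm_triangle y x z; lra.
Qed.

Lemma boundary_dist_continuous : continuous delta.
Proof.
apply: enorm_lipschitz_continuous => x y; rewrite ler_norml lerBlDl.
by rewrite boundary_dist_lip andbT lerNl opprB lerBlDl enormB boundary_dist_lip.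
Qed.

(** Here openness enters: a ball around [x] inside [Omega] misses the boundary. *)
Lemma boundary_dist_gt0 x : Omega x -> 0 < delta x.
Proof.
move=> Ox; have /nbhs_ballP[e /= e0 eO] : nbhs x Omega.
  exact: open_nbhs_nbhs.
rewrite (lt_le_trans e0)//; apply: boundary_dist_ge => y /boundary_openE[_ nOy].
rewrite leNgt; apply/negP => xye; apply/nOy/eO.
by rewrite -ball_normE /ball_/= (le_lt_trans (ler_norm_enorm _)).
Qed.

Lemma boundary_dist_ub : exists2 D, 0 < D & forall x, Omega x -> delta x <= D.
Proof.
have [p bp] := boundary_neq0.
have /pinfty_ex_gt0[M M0 OM] := Omega_bounded.
exists (n%:R * M + enorm p + 1) => [|x Ox].
  by rewrite ltr_wpDl// addr_ge0 ?enorm_ge0// mulr_ge0// ltW.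
rewrite (le_trans (boundary_dist_le _ bp))// (le_trans (ler_enormD _ _))//.
rewrite enormN -[leLHS]addr0 lerD// lerD2r (le_trans (enorm_le_norm _))//.
by rewrite ler_wpM2l// OM.
Qed.

(** An exhaustion of [Omega] by compact sets. The closure makes each of them
    visibly closed, and adds no point when [0 < c], as the distance vanishes on
    the boundary. *)
Definition core (c : R) : set 'rV[R]_n := closure Omega `&` [set x | c <= delta x].

Lemma core_sub c : 0 < c -> core c `<=` Omega.
Proof.
move=> c0 x [cx /= dx]; apply: contrapT => nOx.
by move: dx; rewrite boundary_dist_boundary ?leNgt ?c0//; apply/boundary_openE.
Qed.

Lemma compact_closure : compact (closure Omega).
Proof.
apply: bounded_closed_compact; last exact: closed_closure.
have /pinfty_ex_gt0[M M0 OM] := Omega_bounded.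
apply: filterS (nbhs_pinfty_ge (num_real M)) => N /= MN x cOx.
have cM : closed ((fun y : 'rV[R]_n => `|y|) @^-1` [set r | r <= M]).
  apply: preimage_closed.
    by move=> y _; exact: norm_continuous.
  exact: closed_le.
move/closure_id: cM => cM.
by rewrite (le_trans _ MN)//; have /= := closureS OM cOx; rewrite -cM.
Qed.

Lemma compact_core c : compact (core c).
Proof.
apply: (subclosed_compact _ compact_closure); last by move=> x [].
apply: closedI; first exact: closed_closure.
apply: (@preimage_closed _ _ delta [set y | c <= y]).
  by move=> x _; exact: boundary_dist_continuous.
exact: closed_ge.
Qed.

End BoundaryDistance.

(** * Integrals of continuous functions *)

Section Primitives.
Context {R : realType}.
Implicit Types (f F G : R -> R) (a b c : R).
Local Notation mu := (@lebesgue_measure R).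

Lemma continuous_integrable f a b : continuous f ->
  mu.-integrable `[a, b] (EFin \o f).
Proof.
move=> cf; apply: continuous_compact_integrable; first exact: segment_compact.
exact: continuous_subspaceT.
Qed.

Lemma Rintegral_additive f a b c : continuous f -> a <= b -> b <= c ->
  \int[mu]_(x in `[a, c]) f x =
  \int[mu]_(x in `[a, b]) f x + \int[mu]_(x in `[b, c]) f x.
Proof.
move=> cf ab bc.
have := @Rintegral_itvB R f (BLeft a) (BRight c) b (continuous_integrable a c cf).
rewrite !bnd_simp => /(_ ab bc) h.
rewrite -(@Rintegral_itv_obnd_cbnd R b (BRight c)); first by rewrite -h addrC subrK.
apply: integrableS (continuous_integrable b c cf) => //.
by apply: subset_itvr; rewrite bnd_simp.
Qed.

Lemma is_derive_continuous F (x y : R) : is_derive x 1 F y -> {for x, continuous F}.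
Proof.
by move=> h; apply: differentiable_continuous; apply/derivable1_diffP; case: h.
Qed.

Lemma Rintegral_primitive f F a b : continuous f -> a <= b ->
  (forall x, a <= x -> x <= b -> is_derive x 1 F (f x)) ->
  \int[mu]_(x in `[a, b]) f x = F b - F a.
Proof.
move=> cf; rewrite le_eqVlt => /predU1P[->|ab] dF.
  by rewrite set_itv1 Rintegral_set1 subrr.
rewrite /Rintegral (@continuous_FTC2 _ _ F)//.
- exact: continuous_subspaceT.
- split => [x|//|//].
  + by rewrite in_itv/= => /andP[ax xb]; case: (dF x (ltW ax) (ltW xb)).
  + by apply/cvg_at_right_filter/(is_derive_continuous (dF _ _ _)) => //; exact: ltW.
  + by apply/cvg_at_left_filter/(is_derive_continuous (dF _ _ _)) => //; exact: ltW.
- move=> x; rewrite in_itv/= => /andP[ax xb].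
  by rewrite derive1E; have [_ ->] := dF x (ltW ax) (ltW xb).
Qed.

(** The primitive is based at [a - 1], so that it is differentiable on both
    sides of [a]. *)
Lemma ex_primitive f a : continuous f ->
  exists2 F : R -> R, (forall x, a <= x -> is_derive x 1 F (f x)) &
  forall u v, a <= u -> u <= v -> \int[mu]_(x in `[u, v]) f x = F v - F u.
Proof.
move=> cf; pose F x := \int[mu]_(t in `[a - 1, x]) f t.
have dF x : a <= x -> is_derive x 1 F (f x).
  move=> ax.
  have [] := @continuous_FTC1_closed _ f (a - 1) x (x + 1) _ _ _ (cf x).
  - by rewrite ltrDl.
  - exact: continuous_integrable.
  - lra.
  - by move=> dFx; rewrite derive1E => fE; exact: (DeriveDef dFx fE).
exists F => // u v au uv; apply: Rintegral_primitive => // x ux _.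
exact/dF/(le_trans au).
Qed.

Lemma primitive_le_bound f F a b c : a <= b ->
  (forall t, a <= t -> t <= b -> is_derive t 1 F (f t)) ->
  (forall t, a <= t -> t <= b -> f t <= c) -> F b - F a <= c * (b - a).
Proof.
move=> ab dF fM; have [||t] := @MVT_segment _ F f a b ab.
- by move=> t; rewrite in_itv/= => /andP[? ?]; apply: dF; exact: ltW.
- apply/continuous_in_subspaceT => t; rewrite inE/= in_itv/= => /andP[at_ tb].
  exact: (is_derive_continuous (dF t at_ tb)).
- rewrite in_itv/= => /andP[at_ tb] ->; rewrite ler_wpM2r ?subr_ge0//.
  exact: fM.
Qed.

Lemma primitive_ge_bound f F a b c : a <= b ->
  (forall t, a <= t -> t <= b -> is_derive t 1 F (f t)) ->
  (forall t, a <= t -> t <= b -> c <= f t) -> c * (b - a) <= F b - F a.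
Proof.
move=> ab dF fM; have [||t] := @MVT_segment _ F f a b ab.
- by move=> t; rewrite in_itv/= => /andP[? ?]; apply: dF; exact: ltW.
- apply/continuous_in_subspaceT => t; rewrite inE/= in_itv/= => /andP[at_ tb].
  exact: (is_derive_continuous (dF t at_ tb)).
- rewrite in_itv/= => /andP[at_ tb] ->; rewrite ler_wpM2r ?subr_ge0//.
  exact: fM.
Qed.

Lemma Rintegral_shift f a b c : continuous f -> a <= b ->
  \int[mu]_(x in `[a + c, b + c]) f (x - c) = \int[mu]_(x in `[a, b]) f x.
Proof.
move=> cf ab; have [F dF ->//] := ex_primitive a cf.
have dG x : a + c <= x -> x <= b + c ->
    is_derive x 1 (F \o (fun x => x - c)) (f (x - c)).
  move=> ax xb; rewrite -[f _]mulr1.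
  have h : is_derive x 1 (fun x => x - c) (1 : R).
    by apply: is_derive_eq; rewrite subr0.
  by apply: is_derive1_comp; apply: dF; rewrite lerBrDr.
rewrite (Rintegral_primitive _ _ dG) ?lerD2r//= ?addrK// => x.
apply: continuous_comp; last exact: cf.
by apply: cvgB; [exact: cvg_id|exact: cvg_cst].
Qed.

Lemma Rintegral_opp f a b : continuous f -> a <= b ->
  \int[mu]_(x in `[- b, - a]) f (- x) = \int[mu]_(x in `[a, b]) f x.
Proof.
move=> cf ab; have [F dF ->//] := ex_primitive a cf.
have dG x : - b <= x -> x <= - a -> is_derive x 1 (- (F \o -%R)) (f (- x)).
  move=> ax xb; rewrite -[f _]opprK -[- f _]mulrN1.
  apply: is_deriveN.
  by apply: is_derive1_comp; apply: dF; rewrite lerNr.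
rewrite (Rintegral_primitive _ _ dG) ?lerN2//=.
  by rewrite !fctE !opprK addrC.
by move=> x; apply: continuous_comp; [exact: oppr_continuous|exact: cf].
Qed.

Lemma lipschitz_real_continuous f (C : R) :
  (forall s t, `|f s - f t| <= C * `|s - t|) -> continuous f.
Proof.
move=> fl x; apply/cvgrPdist_lt => e e0.
have C0 : 0 < `|C| + 1 by rewrite ltr_wpDl.
have c0 : 0 < e / (`|C| + 1) by rewrite divr_gt0.
have : \forall y \near x, `|x - y| < e / (`|C| + 1).
  by have := nbhsx_ballx x _ c0; rewrite -ball_normE.
apply: filterS => y; rewrite ltr_pdivlMr// => xy.
rewrite (le_lt_trans (fl _ _))// (le_lt_trans _ xy)// mulrC ler_wpM2l//.
by rewrite (le_trans (ler_norm C))// lerDl.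
Qed.

(** A function whose decrease over an interval is at most quadratic in the
    length is nondecreasing: cutting the interval in two halves the bound. *)
Lemma quadratic_nondecreasing (G : R -> R) a b (C : R) : a <= b ->
  (forall s t, a <= s -> s <= t -> t <= b -> G s <= G t + C * (t - s) ^+ 2) ->
  G a <= G b.
Proof.
move=> ab h.
have hk k : forall s t, a <= s -> s <= t -> t <= b ->
    G s <= G t + C * (t - s) ^+ 2 / 2 ^+ k.
  elim: k => [|k ih] s t as_ st tb; first by rewrite expr0 divr1 h.
  (* Twice the bound for half the length is half the bound. *)
  have m1 : s <= (s + t) / 2 by lra.
  have m2 : (s + t) / 2 <= t by lra.
  have := ih _ _ as_ m1 (le_trans m2 tb).
  have := ih _ _ (le_trans as_ m1) m2 tb.
  rewrite (exprSr 2 k) invfM.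
  set u := (2 ^+ k)^-1.
  have -> : (s + t) / 2 - s = (t - s) / 2 by field.
  have -> : t - (s + t) / 2 = (t - s) / 2 by field.
  have -> : C * ((t - s) / 2) ^+ 2 * u = C * (t - s) ^+ 2 * (u / 2) / 2 by field.
  lra.
apply/ler_addgt0Pr => e e0.
pose D := `|C * (b - a) ^+ 2|.
have [k hk2] : exists k, D / e < 2 ^+ k.
  exists (Num.trunc (D / e)).+1.
  apply: lt_trans (_ : (Num.trunc (D / e)).+1%:R < _); last first.
    by rewrite -natrX ltr_nat ltn_expl.
  exact: truncnS_gt.
apply: le_trans (hk k a b _ _ _) _ => //.
rewrite lerD2l ler_pdivrMr ?exprn_gt0// (le_trans (ler_norm _))//.
by rewrite [leRHS]mulrC -ler_pdivrMr// ltW.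
Qed.

End Primitives.

(** * Lengths of curves *)

Section PolygonalLength.
Context {R : realType} {n : nat} (g : R -> 'rV[R]_n).
Implicit Types (a b s t u x : R) (l : seq R).

Lemma polygonal_length_nil a : polygonal_length g a [::] = 0.
Proof. by rewrite /polygonal_length big_ord0. Qed.

Lemma polygonal_length_cons a x l :
  polygonal_length g a (x :: l) = enorm (g x - g a) + polygonal_length g x l.
Proof.
rewrite /polygonal_length big_ord_recl/=; congr (_ + _).
apply: eq_bigr => i _.
have il : (i < size l)%N by exact: ltn_ord.
rewrite add0n; congr (enorm (g _ - g _)); apply: set_nth_default => //=.
by rewrite ltnS ltnW.
Qed.

Lemma polygonal_length_cat a l l' : polygonal_length g a (l ++ l') =
  polygonal_length g a l + polygonal_length g (last a l) l'.
Proof.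
elim: l a => [|x l ih] a /=; first by rewrite polygonal_length_nil add0r.
by rewrite !polygonal_length_cons ih addrA.
Qed.

Lemma polygonal_length_ge0 a l : 0 <= polygonal_length g a l.
Proof. by apply: sumr_ge0 => i _; exact: enorm_ge0. Qed.

Lemma polygonal_length_le_curve_length a b l : itv_partition a b l ->
  ((polygonal_length g a l)%:E <= curve_length g a b)%E.
Proof. by move=> abl; apply: ereal_sup_ubound; exists l. Qed.

(** The chord: the coarsest subdivision, which is empty when [a = b]. *)
Lemma ex_chord a b : a <= b -> exists2 l, itv_partition a b l &
  polygonal_length g a l = enorm (g b - g a).
Proof.
rewrite le_eqVlt => /predU1P[->|ab].
  exists [::]; first by split => /=.
  by rewrite polygonal_length_nil subrr enorm0.
exists [:: b]; first exact: itv_partition1.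
by rewrite polygonal_length_cons polygonal_length_nil addr0.
Qed.

(** A subdivision of [[s, t]] is completed to one of [[a, b]] by two chords. *)
Lemma curve_length_sub a s t b : a <= s -> s <= t -> t <= b ->
  (curve_length g s t <= curve_length g a b)%E.
Proof.
move=> as_ st tb; apply: ge_ereal_sup => _ [l stl <-].
have [l0 asl0 _] := ex_chord as_; have [l1 tbl1 _] := ex_chord tb.
have := polygonal_length_le_curve_length
  (itv_partition_cat asl0 (itv_partition_cat stl tbl1)).
apply: le_trans; rewrite lee_fin !polygonal_length_cat.
have -> : last a l0 = s by case: asl0 => _ /eqP.
have -> : last s l = t by case: stl => _ /eqP.
by rewrite ler_wpDl ?polygonal_length_ge0// lerDl polygonal_length_ge0.
Qed.

End PolygonalLength.

Section Rectifiable.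
Context {R : realType} {n : nat} (g : R -> 'rV[R]_n) (a b : R).
Hypothesis g_rect : rectifiable_curve g a b.
Implicit Types (s t u x : R) (l : seq R).

Let len s t : R := fine (curve_length g s t).

Lemma rectifiable_le : a <= b. Proof. by case: g_rect. Qed.

Lemma curve_length_fin s t : a <= s -> s <= t -> t <= b ->
  curve_length g s t \is a fin_num.
Proof.
move=> as_ st tb; have [_ _ gfin] := g_rect.
have [l stl _] := ex_chord g st.
rewrite fin_numElt (lt_le_trans _ (polygonal_length_le_curve_length g stl)) ?ltNyr//.
by rewrite (le_lt_trans _ gfin)// curve_length_sub.
Qed.

Lemma len_ge_polygonal s t l : a <= s -> s <= t -> t <= b ->
  itv_partition s t l -> polygonal_length g s l <= len s t.
Proof.
move=> as_ st tb /(polygonal_length_le_curve_length g).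
by rewrite -[X in (_ <= X)%E]fineK ?curve_length_fin// lee_fin.
Qed.

Lemma len_ge_chord s t : a <= s -> s <= t -> t <= b ->
  enorm (g t - g s) <= len s t.
Proof.
by move=> as_ st tb; have [l stl <-] := ex_chord g st; exact: len_ge_polygonal.
Qed.

Lemma len_ge0 s t : a <= s -> s <= t -> t <= b -> 0 <= len s t.
Proof.
by move=> *; apply: le_trans (enorm_ge0 _) _; last exact: len_ge_chord.
Qed.

Lemma len_adherent s t e : a <= s -> s <= t -> t <= b -> 0 < e ->
  exists2 l, itv_partition s t l & len s t - e < polygonal_length g s l.
Proof.
move=> as_ st tb e0.
have := ub_ereal_sup_adherent e0 (curve_length_fin as_ st tb).
move=> [_ [l stl <-] h]; exists l => //; rewrite -lte_fin EFinB.
by rewrite /len fineK ?curve_length_fin.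
Qed.

Let len_super s t u : a <= s -> s <= t -> t <= u -> u <= b ->
  len s t + len t u <= len s u.
Proof.
move=> as_ st tu ub; apply/ler_addgt0Pr => e e0.
have e20 : 0 < e / 2 by rewrite divr_gt0.
have [l stl hl] := len_adherent as_ st (le_trans tu ub) e20.
have [l' tul' hl'] := len_adherent (le_trans as_ st) tu ub e20.
have := len_ge_polygonal as_ (le_trans st tu) ub (itv_partition_cat stl tul').
rewrite polygonal_length_cat; case: stl => _ /eqP ->; lra.
Qed.

(** Inserting the point [t] in a subdivision does not decrease the polygonal
    length. *)
Let polygonal_length_split s t u l : a <= s -> s <= t -> t <= u -> u <= b ->
  itv_partition s u l -> polygonal_length g s l <= len s t + len t u.
Proof.
elim: l s => [|x l ih] s as_ st tu ub sul.
  by rewrite polygonal_length_nil addr_ge0// len_ge0// ?(le_trans as_)// (le_trans tu).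
have [/andP[/= sx _] _] := sul.
have xul := itv_partition_cons sul; have xu := itv_partition_le xul.
rewrite polygonal_length_cons.
have [xt|tx] := leP x t.
  have := ih x (le_trans as_ (ltW sx)) xt tu ub xul.
  have := len_ge_chord as_ (ltW sx) (le_trans xu ub).
  have := len_super as_ (ltW sx) xt (le_trans tu ub).
  lra.
have txu : itv_partition t u (x :: l).
  by case: xul => p e; split => //=; rewrite tx.
have := len_ge_polygonal (le_trans as_ st) tu ub txu.
rewrite polygonal_length_cons.
have := len_ge_chord as_ st (le_trans tu ub).
have := enorm_triangle (g t) (g x) (g s).
lra.
Qed.

Lemma len_additive s t u : a <= s -> s <= t -> t <= u -> u <= b ->
  len s u = len s t + len t u.
Proof.
move=> as_ st tu ub; apply/eqP; rewrite eq_le len_super// andbT.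
apply/ler_addgt0Pr => e e0.
have [l sul] := len_adherent as_ (le_trans st tu) ub e0.
by have := polygonal_length_split as_ st tu ub sul; lra.
Qed.

(** A subdivision of [[a, x]] that is almost as long as the curve has a last
    chord [[p, x]] which is almost as long as the arc above it; the same then
    holds for the chords [[y, x]] with [y] in between. *)
Let len_left x e : a < x -> x <= b -> 0 < e -> exists2 p, p < x &
  forall y, a <= y -> p <= y -> y <= x -> len y x <= enorm (g x - g y) + e.
Proof.
move=> ax xb e0; have [l axl] := len_adherent (lexx a) (ltW ax) xb e0.
have [] := axl; case/lastP: l axl => [|l x'] axl.
  by move=> _ /= /eqP ax'; move: ax; rewrite ax' ltxx.
rewrite rcons_path last_rcons => /andP[al px] /eqP xx.
rewrite {}xx in px axl *; set p := last a l in al px *.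
rewrite -cats1 polygonal_length_cat -/p polygonal_length_cons.
rewrite polygonal_length_nil addr0 => h.
have apl : itv_partition a p l by split.
have ap := itv_partition_le apl.
exists p => // y ay py yx.
have := len_ge_polygonal (lexx a) ap (le_trans (ltW px) xb) apl.
have := len_additive (lexx a) ap (ltW px) xb.
have := len_additive ap py yx xb.
have := len_ge_chord ap py (le_trans yx xb).
have := enorm_triangle (g y) (g x) (g p).
lra.
Qed.

Let len_right x e : a <= x -> x < b -> 0 < e -> exists2 q, x < q &
  forall y, y <= b -> y <= q -> x <= y -> len x y <= enorm (g y - g x) + e.
Proof.
move=> ax xb e0; have [[|q l] xbl h] := len_adherent ax (ltW xb) (lexx b) e0.
  by case: xbl => _ /= /eqP xb'; move: xb; rewrite xb' ltxx.
have [/andP[/= xq _] _] := xbl.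
have qbl := itv_partition_cons xbl; have qb := itv_partition_le qbl.
exists q => // y yb yq xy.
move: h; rewrite polygonal_length_cons.
have := len_ge_polygonal (le_trans ax (ltW xq)) qb (lexx b) qbl.
have := len_additive ax (ltW xq) qb (lexx b).
have := len_additive ax xy yq qb.
have := len_ge_chord (le_trans ax xy) yq qb.
have := enorm_triangle (g y) (g q) (g x).
lra.
Qed.

(** The length function of a continuous rectifiable curve has no jump: a nearly
    optimal subdivision shows that the arc between [x] and a nearby point is
    hardly longer than its chord, and chords shrink by continuity. *)
Lemma len_continuous : {within `[a, b], continuous (len a)}.
Proof.
have [ab gc _] := g_rect.
apply/subspace_continuousP => x /=; rewrite in_itv/= => /andP[ax xb].
apply/cvgrPdist_le => e e0; have e20 : 0 < e / 2 by rewrite divr_gt0.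
have [p px hp] : exists2 p, p < x & forall y, a <= y -> p <= y -> y <= x ->
    len y x <= enorm (g x - g y) + e / 2.
  move: ax; rewrite le_eqVlt => /predU1P[<-|ax]; last exact: len_left.
  exists (a - 1); first by rewrite ltrBlDr ltrDl.
  move=> y ay _ ya; have -> : y = a by apply/eqP; rewrite eq_le ya.
  have := len_additive (lexx a) (lexx a) (lexx a) ab.
  by rewrite subrr enorm0; lra.
have [q xq hq] : exists2 q, x < q & forall y, y <= b -> y <= q -> x <= y ->
    len x y <= enorm (g y - g x) + e / 2.
  move: xb; rewrite le_eqVlt => /predU1P[->|xb]; last exact: len_right.
  exists (b + 1); first by rewrite ltrDl.
  move=> y ya _ ay; have -> : y = b by apply/eqP; rewrite eq_le ya.
  have := len_additive ab (lexx b) (lexx b) (lexx b).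
  by rewrite subrr enorm0; lra.
have gx : \forall y \near x, y \in `[a, b] -> enorm (g y - g x) < e / 2.
  have /subspace_continuousP/(_ x) := gc.
  rewrite /= in_itv/= ax xb => /(_ isT) gcx.
  have := gcx _ (near_enorm (g x) e20).
  by rewrite /= nbhs_simpl /within/=.
rewrite near_withinE; near=> y => /=; rewrite in_itv/= => /andP[ay yb].
have yp : p <= y by apply: ltW; near: y; exact: lt_nbhsr.
have yq : y <= q by apply: ltW; near: y; exact: lt_nbhsl.
have gyx : enorm (g y - g x) < e / 2.
  by apply: (near gx y) => //; rewrite in_itv/= ay yb.
change (`|len a x - len a y| <= e).
have [yx|/ltW xy] := leP y x.
  have := hp y ay yp yx; have := len_additive (lexx a) ay yx xb.
  by have := len_ge0 ay yx xb; rewrite (enormB (g x)) ler_norml; lra.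
have := hq y yb yq xy; have := len_additive (lexx a) ax xy yb.
by have := len_ge0 ax xy yb; rewrite ler_norml; lra.
Unshelve. all: by end_near. Qed.

End Rectifiable.

(** * Arc-length parametrizations *)

Section ArcLength.
Context {R : realType} {n : nat} (g : R -> 'rV[R]_n) (a b : R).
Hypothesis g_rect : rectifiable_curve g a b.
Implicit Types (s t : R).

Let len t : R := fine (curve_length g a t).
Let L := len b.
Let alpha := arclength_param g a b.

Let lenE t : a <= t -> t <= b -> curve_length g a t = (len t)%:E.
Proof. by move=> at_ tb; rewrite /len fineK// (curve_length_fin g_rect). Qed.

Let lena : len a = 0.
Proof.
have ab := rectifiable_le g_rect.
have := len_additive g_rect (lexx a) (lexx a) (lexx a) ab.
by rewrite -/(len a); lra.
Qed.

Let len_dist s t : a <= s -> s <= t -> t <= b ->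
  enorm (g t - g s) <= len t - len s.
Proof.
move=> as_ st tb; have := len_ge_chord g_rect as_ st tb.
by rewrite /len (len_additive g_rect (lexx a) as_ st tb); lra.
Qed.

(** Every length between [0] and the total length is reached, by the
    intermediate value theorem; otherwise [arclength_param] would take its
    default value. *)
Lemma arclength_paramP s : 0 <= s -> s <= L ->
  exists t, [/\ a <= t, t <= b, len t = s & alpha s = g t].
Proof.
move=> s0 sL; have ab := rectifiable_le g_rect.
have [|t] := IVT ab (len_continuous g_rect) (v := s).
  by rewrite ge_min le_max -/(len a) -/(len b) lena s0 sL orbT.
rewrite in_itv/= => /andP[at_ tb] lts.
have : [set t | t \in `[a, b] /\ curve_length g a t = s%:E] t.
  by rewrite /= in_itv/= at_ tb lenE// /len lts.
rewrite /alpha /arclength_param => ht; have := xgetPex a (ex_intro _ t ht) => /=.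
set t' := xget _ _; rewrite in_itv/= => -[/andP[at' t'b] h].
by exists t'; split => //; rewrite /len h.
Qed.

(** Independence of the parameter chosen by [arclength_param]: two parameters
    of the same length bound an arc of length [0], hence a chord of length [0]. *)
Lemma arclength_param_len t : a <= t -> t <= b -> alpha (len t) = g t.
Proof.
move=> at_ tb; have h u v : a <= u -> u <= v -> v <= b -> len v = len u -> g v = g u.
  move=> au uv vb e; apply/eqP; rewrite -subr_eq0; apply/eqP/enorm_eq0/eqP.
  by rewrite eq_le enorm_ge0 andbT (le_trans (len_dist au uv vb))// e subrr.
have [||t' [at' t'b e ->]] := @arclength_paramP (len t).
- by rewrite (le_trans (enorm_ge0 _) (le_trans (len_dist (lexx a) at_ tb) _))// lena subr0.
- by have := len_dist at_ tb (lexx b); have := enorm_ge0 (g b - g t); rewrite /L; lra.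
- by have [tt'|/ltW t't] := leP t t'; [exact: h|apply/esym/h].
Qed.

Lemma arclength_param_lip s t : 0 <= s -> s <= L -> 0 <= t -> t <= L ->
  enorm (alpha s - alpha t) <= `|s - t|.
Proof.
move=> s0 sL t0 tL.
have [u [au ub <- ->]] := arclength_paramP s0 sL.
have [v [av vb <- ->]] := arclength_paramP t0 tL.
have [uv|/ltW vu] := leP u v.
  by rewrite enormB distrC (le_trans (len_dist au uv vb))// ler_norm.
by rewrite (le_trans (len_dist av vu ub))// ler_norm.
Qed.

Lemma len_total_ge0 : 0 <= L.
Proof.
have ab := rectifiable_le g_rect.
by have := len_dist (lexx a) ab (lexx b); have := enorm_ge0 (g b - g a); rewrite lena -/L; lra.
Qed.

End ArcLength.

(** The retraction of the line onto [[0, L]], used to extend paths by constants. *)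
Definition clamp {R : realType} (L s : R) : R := Num.max 0 (Num.min s L).

Lemma clampP {R : realType} (L s : R) : 0 <= L -> 0 <= clamp L s <= L.
Proof. by move=> L0; rewrite /clamp le_max lexx ge_max L0 ge_min lexx orbT. Qed.

Lemma clamp_id {R : realType} (L s : R) : 0 <= s -> s <= L -> clamp L s = s.
Proof. by move=> s0 sL; rewrite /clamp min_l// max_r. Qed.

Lemma clamp_lip {R : realType} (L s t : R) : `|clamp L s - clamp L t| <= `|s - t|.
Proof.
wlog st : s t / s <= t.
  by move=> h; have [/h//|/ltW/h] := leP s t; rewrite distrC (distrC t).
rewrite (distrC s) (ger0_norm (x := t - s)) ?subr_ge0// ler_norml /clamp.
have max0 (x : R) : (0 <= x /\ Num.max 0 x = x) \/ (x <= 0 /\ Num.max 0 x = 0).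
  by case: (leP 0 x) => [|/ltW] ?; [left|right].
have minL (x : R) : (x <= L /\ Num.min x L = x) \/ (L <= x /\ Num.min x L = L).
  by case: (leP x L) => [|/ltW] ?; [left|right].
by case: (minL s) => -[? ->]; case: (minL t) => -[? ->];
  do ?match goal with |- context[Num.max 0 ?x] => case: (max0 x) => -[? ->] end; lra.
Qed.

(** * Lipschitz paths and their quasihyperbolic cost *)

Section LipschitzPaths.
Context {R : realType} {n : nat} (Omega : set 'rV[R]_n).
Hypothesis Omega_open : open Omega.
Hypothesis boundary_neq0 : boundary Omega !=set0.
Implicit Types (x y z : 'rV[R]_n) (a b c s t r : R) (alpha beta g : R -> 'rV[R]_n).

Local Notation delta := (boundary_dist Omega).
Local Notation mu := (@lebesgue_measure R).
Local Notation rho := (fun u => (delta u)^-1).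

(** Paths are parametrized by the whole line, so that the integrand
    [rho \o alpha] is continuous everywhere and no endpoint needs care. *)
Definition lip_path alpha : Prop :=
  (forall s t, enorm (alpha s - alpha t) <= `|s - t|) /\ forall t, Omega (alpha t).

Definition path_cost alpha a b : R := \int[mu]_(s in `[a, b]) (delta (alpha s))^-1.

Lemma boundary_dist_path_continuous alpha : lip_path alpha ->
  continuous (fun t => delta (alpha t)).
Proof.
move=> [al _]; apply: (@lipschitz_real_continuous _ _ 1) => s t; rewrite mul1r.
have := al s t; have := boundary_dist_lip boundary_neq0 (alpha s) (alpha t).
have := boundary_dist_lip boundary_neq0 (alpha t) (alpha s).
by rewrite (enormB (alpha t)) ler_norml; lra.
Qed.

Lemma density_continuous alpha : lip_path alpha ->
  continuous (fun t => (delta (alpha t))^-1).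
Proof.
move=> la t; apply: cvgV; last exact: boundary_dist_path_continuous.
by rewrite gt_eqF// boundary_dist_gt0//; case: la.
Qed.

(** Two inverses of numbers at least [c] differ by at most their difference
    divided by [c ^ 2]. *)
Lemma density_lip c x y : 0 < c -> c <= delta x -> c <= delta y ->
  (delta x)^-1 <= (delta y)^-1 + (c ^+ 2)^-1 * enorm (x - y).
Proof.
move=> c0 cx cy.
have x0 : 0 < delta x by exact: lt_le_trans cx.
have y0 : 0 < delta y by exact: lt_le_trans cy.
rewrite -lerBlDl.
have -> : (delta x)^-1 - (delta y)^-1 = (delta x * delta y)^-1 * (delta y - delta x).
  by field; rewrite !gt_eqF.
apply: (@le_trans _ _ ((delta x * delta y)^-1 * enorm (x - y))).
  rewrite ler_wpM2l ?invr_ge0 ?mulr_ge0 ?(ltW x0) ?(ltW y0)//.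
  by have := boundary_dist_lip boundary_neq0 y x; rewrite enormB; lra.
rewrite ler_wpM2r ?enorm_ge0// lef_pV2 ?posrE ?exprn_gt0 ?mulr_gt0//.
by rewrite expr2 ler_pM// ltW.
Qed.

(** The arc-length parametrization of a curve in [Omega], made constant
    outside of its interval, is a Lipschitz path of the same cost. *)
Lemma arclength_lip_path g a b : rectifiable_curve g a b ->
  (forall t, t \in `[a, b] -> Omega (g t)) ->
  exists alpha, [/\ lip_path alpha,
    forall t, a <= t -> t <= b -> alpha (fine (curve_length g a t)) = g t,
    forall s, exists2 t, t \in `[a, b] & alpha s = g t &
    line_integral rho g a b = path_cost alpha 0 (fine (curve_length g a b))].
Proof.
move=> gr gO; set L := fine (curve_length g a b).
have L0 : 0 <= L := len_total_ge0 gr.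
pose alpha s := arclength_param g a b (clamp L s).
have ag s : exists2 t, t \in `[a, b] & alpha s = g t.
  have /andP[c0 cL] := clampP s L0.
  have [t [at_ tb _ e]] := arclength_paramP gr c0 cL.
  by exists t => //; rewrite in_itv/= at_ tb.
exists alpha; split; [|  |exact: ag|].
- split=> [s t|t]; last by have [u uab ->] := ag t; exact: gO.
  have /andP[? ?] := clampP s L0; have /andP[? ?] := clampP t L0.
  by apply: le_trans (clamp_lip L s t); exact: (arclength_param_lip gr).
- move=> t at_ tb; rewrite -(arclength_param_len gr at_ tb) /alpha clamp_id//.
    exact: (len_ge0 gr).
  rewrite /L (len_additive gr (lexx a) at_ tb (lexx b)) lerDl.
  exact: (len_ge0 gr).
- apply: eq_Rintegral => s; rewrite inE/= in_itv/= => /andP[s0 sL].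
  by rewrite /alpha clamp_id.
Qed.

Lemma lip_path_rectifiable alpha a b : a <= b -> lip_path alpha ->
  rectifiable_curve alpha a b.
Proof.
move=> ab [al _]; split => //.
  apply: continuous_subspaceT => t; apply/cvgrPdist_le => e e0.
  have := @nbhsx_ballx _ _ t e e0; rewrite -ball_normE.
  apply: filterS => s ts; rewrite (le_trans (ler_norm_enorm _))//.
  by rewrite (le_trans (al t s))// ltW.
apply: (@le_lt_trans _ _ (b - a)%:E); last exact: ltry.
apply: ge_ereal_sup => _ [l abl <-]; rewrite lee_fin {ab}.
elim: l a abl => [|x l ih] a abl.
  by rewrite (itv_partition_nil abl) polygonal_length_nil subrr.
have [/andP[/= ax _] _] := abl.
rewrite polygonal_length_cons; have := ih x (itv_partition_cons abl).
by have := al x a; rewrite ger0_norm ?subr_ge0 ?(ltW ax)//; lra.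
Qed.

Lemma lip_path_len_le alpha a s t b : lip_path alpha -> a <= s -> s <= t -> t <= b ->
  fine (curve_length alpha s t) <= t - s.
Proof.
move=> la as_ st tb.
have gr := lip_path_rectifiable st la.
rewrite -lee_fin fineK ?(curve_length_fin gr)//.
case: la => al _.
apply: ge_ereal_sup => _ [l abl <-]; rewrite lee_fin.
elim: l s abl {as_ st gr} => [|x l ih] s abl.
  by rewrite (itv_partition_nil abl) polygonal_length_nil subrr.
have [/andP[/= ax _] _] := abl.
rewrite polygonal_length_cons; have := ih x (itv_partition_cons abl).
by have := al x s; rewrite ger0_norm ?subr_ge0 ?(ltW ax)//; lra.
Qed.

(** Running along a path at speed at most [1] costs at least as much as
    running along it at unit speed. With [H] and [F] primitives of the
    densities along [alpha] and along its arc-length parametrization, and [l]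
    its length function, [H t - F (l t)] is nondecreasing, because the two
    densities are Lipschitz and agree at corresponding points. *)
Lemma line_integral_le_path_cost alpha a b : a <= b -> lip_path alpha ->
  line_integral rho alpha a b <= path_cost alpha a b.
Proof.
move=> ab la; have gr := lip_path_rectifiable ab la.
have aO t : t \in `[a, b] -> Omega (alpha t) by case: la.
have [beta [lb bl ba ->]] := arclength_lip_path gr aO.
pose l t := fine (curve_length alpha a t).
have l0 : l a = 0.
  have := len_additive gr (lexx a) (lexx a) (lexx a) ab.
  by rewrite -/(l a); lra.
have lD s t : a <= s -> s <= t -> t <= b -> 0 <= l t - l s <= t - s.
  move=> as_ st tb; rewrite /l (len_additive gr (lexx a) as_ st tb).
  by rewrite addrC addKr (len_ge0 gr)//= (lip_path_len_le la as_ st tb).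
have [c c0 hc] : exists2 c, 0 < c & forall t, a <= t -> t <= b -> c <= delta (alpha t).
  have [|u uab hu] := @EVT_min R (fun t => delta (alpha t)) a b ab.
    exact/continuous_subspaceT/boundary_dist_path_continuous.
  exists (delta (alpha u)).
    by apply: boundary_dist_gt0 => //; case: la.
  by move=> t at_ tb; apply: hu; rewrite in_itv/= at_ tb.
have hcb s : c <= delta (beta s).
  by have [t + ->] := ba s; rewrite in_itv/= => /andP[at_ tb]; exact: hc.
have [H dH HE] := ex_primitive a (density_continuous la).
have [F dF FE] := ex_primitive 0 (density_continuous lb).
rewrite /path_cost HE// FE//; last first.
  by have := lD _ _ (lexx a) ab (lexx b); rewrite l0 subr0 => /andP[].
rewrite -/(l b).
suff : H a - F (l a) <= H b - F (l b) by rewrite l0; lra.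
pose C := (c ^+ 2)^-1; have C0 : 0 <= C by rewrite invr_ge0 exprn_ge0// ltW.
apply: (@quadratic_nondecreasing _ (fun t => H t - F (l t)) a b (C + C)) => // s t as_ st tb.
have /andP[ls lt] := lD s t as_ st tb.
have /andP[la0 _] := lD _ _ (lexx a) as_ (le_trans st tb).
set r := (delta (alpha s))^-1.
have r0 : 0 <= r by rewrite invr_ge0 boundary_dist_ge0.
have hH : (r - C * (t - s)) * (t - s) <= H t - H s.
  apply: primitive_ge_bound => // u su ut; first exact/dH/(le_trans as_).
  have := density_lip c0 (hc s as_ (le_trans st tb)) (hc u (le_trans as_ su) (le_trans ut tb)).
  rewrite -/r -/C => h; rewrite lerBlDr (le_trans h)// lerD2l ler_wpM2l//.
  by rewrite (le_trans (la.1 s u))// distrC ger0_norm ?subr_ge0// lerD2r.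
have hF : F (l t) - F (l s) <= (r + C * (t - s)) * (l t - l s).
  have ls0 : 0 <= l s by lra.
  apply: primitive_le_bound => [|u su ut|u su ut].
  - by rewrite -subr_ge0.
  - exact/dF/(le_trans _ su).
  - have := density_lip c0 (hcb u) (hcb (l s)).
    rewrite (bl s as_ (le_trans st tb)) -/r -/C => h.
    rewrite (le_trans h)// lerD2l ler_wpM2l// -(bl s as_ (le_trans st tb)) -/(l s).
    rewrite (le_trans (lb.1 u (l s)))// ger0_norm ?subr_ge0//.
    by rewrite (le_trans _ lt)// lerD2r.
have : (r + C * (t - s)) * (l t - l s) <= (r + C * (t - s)) * (t - s).
  by rewrite ler_wpM2l// addr_ge0// mulr_ge0// subr_ge0.
have -> : (C + C) * (t - s) ^+ 2 =
  (r + C * (t - s)) * (t - s) - (r - C * (t - s)) * (t - s) by ring.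
lra.
Qed.

End LipschitzPaths.

(** * The quasihyperbolic metric *)

Section QuasihyperbolicMetric.
Context {R : realType} {n : nat} (Omega : set 'rV[R]_n).
Hypothesis Omega_open : open Omega.
Hypothesis Omega_connected : connected Omega.
Hypothesis Omega_bounded : bounded_set Omega.
Hypothesis boundary_neq0 : boundary Omega !=set0.
Implicit Types (x y z : 'rV[R]_n) (a b c e s t r : R) (alpha beta : R -> 'rV[R]_n).

Local Notation delta := (boundary_dist Omega).
Local Notation mu := (@lebesgue_measure R).
Local Notation rho := (fun u => (delta u)^-1).
Local Notation k := (qh_dist Omega).

(** By [qh_dist_le] and [qh_dist_ge] below, the quasihyperbolic distance is the
    infimum of the [r] in this relation. Lipschitz paths, unlike arc-length
    parametrized curves, are trivially closed under reversal and
    concatenation. *)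
Definition path_joins x y r : Prop := exists alpha a b,
  [/\ a <= b, lip_path Omega alpha, alpha a = x, alpha b = y &
      path_cost Omega alpha a b = r].

Lemma path_joins_sym x y r : path_joins x y r -> path_joins y x r.
Proof.
move=> [alpha [a [b [ab la ax bY <-]]]].
exists (alpha \o -%R), (- b), (- a); split.
- by rewrite lerN2.
- split=> [s t|t] /=; last by case: la.
  by apply: le_trans (la.1 _ _) _; rewrite -opprD normrN.
- by rewrite /= opprK.
- by rewrite /= opprK.
- have cf := density_continuous Omega_open boundary_neq0 la.
  exact: (Rintegral_opp cf ab).
Qed.

Lemma path_joins_trans x y z r s :
  path_joins x y r -> path_joins y z s -> path_joins x z (r + s).
Proof.
move=> [alpha [a [b [ab la ax bY <-]]]] [beta [a' [b' [ab' lb ay bz <-]]]].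
pose gamma t := if t <= b then alpha t else beta (t - (b - a')).
have gb t : b <= t -> gamma t = beta (t - (b - a')).
  move=> bt; rewrite /gamma; case: ifPn => // tb.
  have -> : t = b by apply/eqP; rewrite eq_le tb.
  by rewrite bY opprB addrC subrK ay.
have lg : lip_path Omega gamma.
  split=> [u t|t]; last by rewrite /gamma; case: ifP => _; [exact: la.2|exact: lb.2].
  wlog st : u t / u <= t.
    by move=> h; have [/h//|/ltW/h] := leP u t; rewrite enormB distrC.
  have [tb|/ltW bt] := leP t b.
    by rewrite /gamma tb (le_trans st tb); exact: la.1.
  have [sb|/ltW bs] := leP u b; last first.
    rewrite !gb//; apply: le_trans (lb.1 _ _) _.
    by have -> : u - (b - a') - (t - (b - a')) = u - t by ring.
  rewrite distrC ger0_norm ?subr_ge0//.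
  have := la.1 u b; rewrite distrC ger0_norm ?subr_ge0// => h1.
  have := lb.1 (b - (b - a')) (t - (b - a')); rewrite -!gb// => h2.
  have := enorm_triangle (gamma b) (gamma u) (gamma t).
  have e : `|b - (b - a') - (t - (b - a'))| = t - b.
    have -> : b - (b - a') - (t - (b - a')) = b - t by ring.
    by rewrite distrC ger0_norm// subr_ge0.
  rewrite e in h2.
  have gu : gamma u = alpha u by rewrite /gamma sb.
  have gbb : gamma b = alpha b by rewrite /gamma lexx.
  by rewrite -gu -gbb in h1; lra.
have bb' : b <= b' + (b - a') by lra.
exists gamma, a, (b' + (b - a')); split; [|exact: lg| | |].
- exact: le_trans bb'.
- by rewrite /gamma ab.
- by rewrite gb// addrK.
rewrite /path_cost.
rewrite (Rintegral_additive (density_continuous Omega_open boundary_neq0 lg) ab bb').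
have -> : \int[mu]_(t in `[a, b]) (delta (gamma t))^-1 =
    \int[mu]_(t in `[a, b]) (delta (alpha t))^-1.
  apply: eq_Rintegral => t; rewrite inE/= in_itv/= => /andP[_ tb].
  by rewrite /gamma tb.
have -> : \int[mu]_(t in `[b, b' + (b - a')]) (delta (gamma t))^-1 =
    \int[mu]_(t in `[b, b' + (b - a')]) (delta (beta (t - (b - a'))))^-1.
  apply: eq_Rintegral => t; rewrite inE/= in_itv/= => /andP[bt _].
  by rewrite gb.
have /= <- := Rintegral_shift (b - a')
  (density_continuous Omega_open boundary_neq0 lb) ab'.
by have -> : a' + (b - a') = b by rewrite addrC subrK.
Qed.

(** Segments: a path from [x] to a nearby point stays where the density is at
    most [2 / delta x]. *)
Lemma path_joins_near x : Omega x -> exists2 M, 0 < M &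
  \forall y \near x, exists2 r, path_joins x y r & r <= M * enorm (y - x).
Proof.
move=> Ox; have d0 := boundary_dist_gt0 Omega_open boundary_neq0 Ox.
exists (2 / delta x); first by rewrite divr_gt0.
have /nbhs_ballP[e /= e0 eO] : nbhs x Omega by exact: open_nbhs_nbhs.
have de0 : 0 < Num.min e (delta x / 2) by rewrite lt_min e0 divr_gt0.
apply: filterS (near_enorm x de0) => y; rewrite lt_min => /andP[ye yd].
set L := enorm (y - x) in ye yd *.
have L0 : 0 <= L := enorm_ge0 _.
pose alpha t := x + (clamp L t / L) *: (y - x).
have aD s t : enorm (alpha s - alpha t) <= `|clamp L s - clamp L t|.
  have -> : alpha s - alpha t = ((clamp L s - clamp L t) / L) *: (y - x).
    by rewrite /alpha opprD addrACA subrr add0r -scalerBl mulrBl.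
  rewrite enormZ normrM normfV (ger0_norm L0) -mulrA -/L.
  have [->|L0'] := eqVneq L 0; first by rewrite !mulr0.
  by rewrite mulVf// mulr1.
have a0 : alpha 0 = x by rewrite /alpha clamp_id// mul0r scale0r addr0.
have aL : alpha L = y.
  rewrite /alpha clamp_id//; have [L0'|L0'] := eqVneq L 0.
    by have /enorm_eq0 -> := L0'; rewrite scaler0 addr0 -(subrK x y) (enorm_eq0 L0') add0r.
  by rewrite divff// scale1r addrC subrK.
have ax t : enorm (alpha t - x) <= L.
  have /andP[c0 cL] := clampP t L0.
  have := aD t 0; rewrite a0 [clamp L 0]clamp_id// subr0 ger0_norm// => h.
  exact: le_trans cL.
have la : lip_path Omega alpha.
  split=> [s t|t]; first by apply: le_trans (aD s t) (clamp_lip _ _ _).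
  apply: eO; rewrite -ball_normE /ball_/= distrC (le_lt_trans (ler_norm_enorm _))//.
  exact: le_lt_trans (ax t) ye.
exists (path_cost Omega alpha 0 L); first by exists alpha, 0, L; split.
have [F dF FE] := ex_primitive 0 (density_continuous Omega_open boundary_neq0 la).
rewrite /path_cost FE// -[X in _ <= _ * X]subr0; apply: primitive_le_bound => // [t t0 _|t _ _].
  exact: dF.
have -> : 2 / delta x = (delta x / 2)^-1 by rewrite invfM invrK mulrC.
rewrite lef_pV2 ?posrE ?divr_gt0//; last first.
  by apply: (boundary_dist_gt0 Omega_open boundary_neq0); case: la.
have := boundary_dist_lip boundary_neq0 x (alpha t); have := ax t.
rewrite (enormB x); lra.
Qed.

Lemma path_joins_refl x : Omega x -> path_joins x x 0.
Proof.
move=> Ox; exists (fun=> x), 0, 0; split; [by []| |by []|by []|].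
  by split=> // s t; rewrite subrr enorm0.
by rewrite /path_cost set_itv1 Rintegral_set1.
Qed.

(** The points that can be joined to [x] form an open and closed subset of the
    connected set [Omega]; without a joining path the infimum defining the
    distance would be that of the empty set. *)
Lemma ex_path_joins x y : Omega x -> Omega y -> exists r, path_joins x y r.
Proof.
move=> Ox Oy; pose B := [set z | Omega z /\ exists r, path_joins x z r].
suff : B = Omega by move=> BE; have [] : B y by rewrite BE.
apply: Omega_connected.
- by exists x; split => //; exists 0; exact: path_joins_refl.
- exists B; last by apply/seteqP; split => [z|z []//]; split => //; case: H.
  rewrite openE => z [Oz [r xzr]]; have [M _ zM] := path_joins_near Oz.
  have zO : nbhs z Omega by exact: open_nbhs_nbhs.
  apply: filterS2 zO zM => u Ou [s zus _]; split => //.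
  by exists (r + s); exact: path_joins_trans zus.
- exists (closure B); first exact: closed_closure.
  apply/seteqP; split => [z Bz|z [Oz cBz]].
    by split; [case: Bz|exact: subset_closure].
  split => //; have [M _ zM] := path_joins_near Oz.
  have [u [[_ [r xur]] [s zus _]]] := cBz _ zM.
  by exists (r + s); apply: path_joins_trans xur _; exact: path_joins_sym.
Qed.

Let density_ge0 u : 0 <= rho u.
Proof. by rewrite invr_ge0 boundary_dist_ge0. Qed.

Let line_integral_lbound x y : lbound [set r | exists g a b,
  curve_joining Omega x y g a b /\ r = line_integral rho g a b] 0.
Proof. by move=> _ [g [a [b [_ ->]]]]; apply: Rintegral_ge0 => s _; exact: density_ge0. Qed.

Lemma qh_dist_le x y r : path_joins x y r -> k x y <= r.
Proof.
move=> [alpha [a [b [ab la <- <- <-]]]].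
apply: le_trans (line_integral_le_path_cost Omega_open boundary_neq0 ab la).
apply: ge_inf; first by exists 0; exact: line_integral_lbound.
exists alpha, a, b; split; last by [].
split; [exact: (lip_path_rectifiable ab la)| |by []|by []].
by move=> t _; case: la.
Qed.

Lemma qh_dist_ge x y m : Omega x -> Omega y ->
  (forall r, path_joins x y r -> m <= r) -> m <= k x y.
Proof.
move=> Ox Oy h; apply: lb_le_inf.
  have [r [alpha [a [b [ab la ax bY _]]]]] := ex_path_joins Ox Oy.
  exists (line_integral rho alpha a b), alpha, a, b.
  split; last by [].
  split; [exact: (lip_path_rectifiable ab la)| |by []|by []].
  by move=> t _; case: la.
move=> _ [g [a [b [[gr gO ga gb] ->]]]].
have [alpha [la ag _ ->]] := arclength_lip_path gr gO.
have ab := rectifiable_le gr.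
apply: h; exists alpha, 0, (fine (curve_length g a b)).
split; [|exact: la| | |by []].
- exact: len_total_ge0 gr.
- rewrite -ga -(ag a (lexx a) ab); congr alpha.
  by have := len_additive gr (lexx a) (lexx a) (lexx a) ab; lra.
- by rewrite ag.
Qed.

Lemma qh_dist_adherent x y e : Omega x -> Omega y -> 0 < e ->
  exists2 r, path_joins x y r & r < k x y + e.
Proof.
move=> Ox Oy e0; apply: contrapT => h.
suff : k x y + e <= k x y by lra.
apply: qh_dist_ge => // r xyr; rewrite leNgt; apply/negP => re.
by apply: h; exists r.
Qed.

Lemma qh_dist_ge0 x y : 0 <= k x y.
Proof.
rewrite /qh_dist; have [->|/set0P h] := eqVneq [set r | exists g a b,
  curve_joining Omega x y g a b /\ r = line_integral rho g a b] set0.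
  by rewrite inf0.
exact: lb_le_inf.
Qed.

Lemma qh_dist_sym x y : Omega x -> Omega y -> k x y = k y x.
Proof.
move=> Ox Oy; apply/eqP; rewrite eq_le.
by apply/andP; split; apply: qh_dist_ge => // r /path_joins_sym; exact: qh_dist_le.
Qed.

Lemma qh_dist_triangle y x z : Omega x -> Omega y -> Omega z ->
  k x z <= k x y + k y z.
Proof.
move=> Ox Oy Oz; apply/ler_addgt0Pr => e e0.
have e20 : 0 < e / 2 by rewrite divr_gt0.
have [r xyr hr] := qh_dist_adherent Ox Oy e20.
have [s yzs hs] := qh_dist_adherent Oy Oz e20.
by have := qh_dist_le (path_joins_trans xyr yzs); lra.
Qed.

Lemma qh_dist_near x e : Omega x -> 0 < e -> \forall y \near x, k x y < e.
Proof.
move=> Ox e0; have [M M0 xM] := path_joins_near Ox.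
have eM : 0 < e / M by rewrite divr_gt0.
apply: filterS2 xM (near_enorm x eM) => y [r xyr rM].
rewrite ltr_pdivlMr// mulrC => h.
exact: le_lt_trans (qh_dist_le xyr) (le_lt_trans rM h).
Qed.

(** As [Omega] is bounded, [1 / delta] is bounded below by a positive constant. *)
Lemma enorm_le_qh_dist : exists2 D, 0 < D &
  forall x y, Omega x -> Omega y -> enorm (x - y) <= D * k x y.
Proof.
have [D D0 OD] := boundary_dist_ub Omega_bounded boundary_neq0.
exists D => // x y Ox Oy; rewrite mulrC -ler_pdivrMr//.
apply: qh_dist_ge => // _ [alpha [a [b [ab la <- <- <-]]]].
have [F dF FE] := ex_primitive a (density_continuous Omega_open boundary_neq0 la).
rewrite /path_cost FE//; apply: (@le_trans _ _ (D^-1 * (b - a))).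
  rewrite mulrC ler_wpM2l ?invr_ge0 ?(ltW D0)//.
  by apply: le_trans (la.1 a b) _; rewrite distrC ger0_norm// subr_ge0.
apply: primitive_ge_bound => // [t at_ _|t _ _]; first exact: dF.
have Oat := la.2 t.
by rewrite lef_pV2 ?posrE ?OD//; exact: boundary_dist_gt0.
Qed.

(** Along a path from [x] the distance to the boundary grows at most at unit
    speed, so the cost is at least the integral of [1 / (delta x + t)]. *)
Lemma boundary_dist_le_expR x y : Omega x -> Omega y ->
  delta y <= delta x * expR (k x y).
Proof.
move=> Ox Oy.
have x0 := boundary_dist_gt0 Omega_open boundary_neq0 Ox.
have y0 := boundary_dist_gt0 Omega_open boundary_neq0 Oy.
suff : ln (delta y / delta x) <= k x y.
  rewrite -ler_expR lnK; last by rewrite posrE divr_gt0.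
  by rewrite ler_pdivrMr// mulrC.
apply: qh_dist_ge => // _ [alpha [a [b [ab la ax bY <-]]]].
have [F dF FE] := ex_primitive a (density_continuous Omega_open boundary_neq0 la).
rewrite /path_cost FE//.
pose G t := F t - ln (delta x - a + t).
have pos t : a <= t -> 0 < delta x - a + t by lra.
have dG t : a <= t -> is_derive t 1 G ((delta (alpha t))^-1 - (delta x - a + t)^-1).
  move=> at_; apply: is_deriveB; first exact: dF.
  have h1 : is_derive (delta x - a + t) 1 (@ln R) (delta x - a + t)^-1.
    exact/is_derive1_ln/pos.
  have h2 : is_derive t 1 (fun t => delta x - a + t) (1 : R).
    by apply: is_derive_eq; rewrite add0r mulr1.
  by have := @is_derive1_comp _ (@ln R) (fun t => delta x - a + t) t _ _ h1 h2; rewrite mulr1.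
have : 0 * (b - a) <= G b - G a.
  apply: (primitive_ge_bound ab (fun t at_ _ => dG t at_)) => t at_ tb.
  have at0 : 0 < delta (alpha t).
    by apply: boundary_dist_gt0 => //; case: la.
  rewrite subr_ge0 lef_pV2 ?posrE ?pos//.
  have := boundary_dist_lip boundary_neq0 (alpha t) x; have := la.1 t a.
  by rewrite ax ger0_norm ?subr_ge0//; lra.
rewrite mul0r /G subrK.
have : ln (delta y) <= ln (delta x - a + b).
  rewrite ler_ln ?posrE ?pos//.
  have := boundary_dist_lip boundary_neq0 y x; have := la.1 b a.
  by rewrite ax bY ger0_norm ?subr_ge0//; lra.
rewrite ln_div ?posrE//; lra.
Qed.

End QuasihyperbolicMetric.

(** * Existence of quasihyperbolic geodesics *)

Section Geodesics.
Context {R : realType} {n : nat} (Omega : set 'rV[R]_n).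
Hypothesis Omega_open : open Omega.
Hypothesis Omega_connected : connected Omega.
Hypothesis Omega_bounded : bounded_set Omega.
Hypothesis boundary_neq0 : boundary Omega !=set0.
Implicit Types (x y z o u v : 'rV[R]_n) (a b c e s t r T : R).

Local Notation delta := (boundary_dist Omega).
Local Notation k := (qh_dist Omega).

Let kC x y : Omega x -> Omega y -> k x y = k y x :=
  qh_dist_sym Omega_open Omega_connected boundary_neq0 (x := x) (y := y).
Let kT y x z : Omega x -> Omega y -> Omega z -> k x z <= k x y + k y z :=
  @qh_dist_triangle _ _ _ Omega_open Omega_connected boundary_neq0 y x z.

(** This is the properness of [k]: a closed ball is contained in a compact
    [core]. It also says that [k o u] tends to infinity as [u] approaches the
    boundary. *)
Lemma core_of_qh_ball o u r : Omega o -> Omega u -> k o u <= r ->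
  core Omega (delta o * expR (- r)) u.
Proof.
move=> Oo Ou h; split; first exact: subset_closure.
rewrite /= expRN ler_pdivrMr ?expR_gt0//.
apply: le_trans (boundary_dist_le_expR Omega_open Omega_connected boundary_neq0 Ou Oo) _.
by rewrite ler_wpM2l ?boundary_dist_ge0// ler_expR kC.
Qed.

(** [k o] is continuous for the Euclidean topology, because [k x y] is small
    when [y] is close to [x]. *)
Lemma qh_dist_bounded_on_compact (K : set 'rV[R]_n) o : compact K -> K `<=` Omega ->
  Omega o -> exists M, forall u, K u -> k o u <= M.
Proof.
move=> cK KO Oo; have [->|/set0P K0] := eqVneq K set0; first by exists 0.
have [|u uK hu] := compact_EVT_max K0 cK (f := k o); last first.
  by exists (k o u) => v Kv; apply: hu; rewrite inE.
apply/subspace_continuousP => x Kx; apply/cvgrPdist_le => e e0.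
have Ox := KO _ Kx.
have xO : nbhs x Omega by exact: open_nbhs_nbhs.
have xe := qh_dist_near Omega_open boundary_neq0 Ox e0.
rewrite near_withinE.
apply: filterS2 xO xe => y Oy /ltW xye _.
have := kT Oo Oy Ox; have := kT Oo Ox Oy; rewrite (kC Oy Ox) ler_norml; lra.
Qed.

(** Reparametrize by its cost a path whose cost exceeds [k x y] by at most [e].
    Sub-paths bound the distances from above; from below, a sub-path cannot be
    shortened by more than the excess of the whole path. *)
Lemma almost_geodesic x y e : Omega x -> Omega y -> 0 < e ->
  exists h : R -> 'rV[R]_n, [/\ forall t, 0 <= t -> t <= k x y -> Omega (h t),
    forall s t, 0 <= s -> s <= t -> t <= k x y -> `|k (h s) (h t) - (t - s)| <= e,
    k x (h 0) <= e & k (h (k x y)) y <= e].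
Proof.
move=> Ox Oy e0; set T := k x y.
have [r [alpha [a [b [ab la ax bY cr]]]] rT] :=
  qh_dist_adherent Omega_open Omega_connected boundary_neq0 Ox Oy e0.
have Tr : T <= r.
  by apply: (qh_dist_le Omega_open boundary_neq0); exists alpha, a, b.
have [F dF FE] := ex_primitive a (density_continuous Omega_open boundary_neq0 la).
have rE : r = F b - F a by rewrite -cr /path_cost FE.
have aO s : Omega (alpha s) by case: la.
have ka (u v : R) : a <= u -> u <= v -> k (alpha u) (alpha v) <= F v - F u.
  move=> au uv; apply: (qh_dist_le Omega_open boundary_neq0).
  by exists alpha, u, v; split; [| |by []|by []|exact: FE].
have ex_u t : exists u : R, 0 <= t -> t <= T -> [/\ a <= u, u <= b & F u = F a + t].
  have [/andP[t0 tT]|ht] := boolP ((0 <= t) && (t <= T)); last first.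
    by exists a => t0 tT; rewrite t0 tT in ht.
  have cF : {within `[a, b], continuous F}.
    apply/continuous_in_subspaceT => v; rewrite inE/= in_itv/= => /andP[av _].
    exact: (is_derive_continuous (dF v av)).
  have [|u] := IVT ab cF (v := F a + t).
    by rewrite ge_min le_max lerDl t0/=; apply/orP; right; lra.
  by rewrite in_itv/= => /andP[au ub] Fu; exists u.
have [c hc] := choice ex_u; have T0 : 0 <= T by exact: qh_dist_ge0.
exists (alpha \o c); split => [t t0 tT|s t s0 st tT||] /=; first exact: aO.
- have [as_ sb Fs] := hc s s0 (le_trans st tT).
  have [at_ tb Ft] := hc t (le_trans s0 st) tT.
  have h1 : k (alpha (c s)) (alpha (c t)) <= t - s.
    have [cst|/ltW cts] := leP (c s) (c t).
      by have := ka _ _ as_ cst; lra.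
    rewrite kC//; have := ka _ _ at_ cts.
    by have := qh_dist_ge0 boundary_neq0 (alpha (c t)) (alpha (c s)); lra.
  have := ka _ _ (lexx a) as_; have := ka _ _ at_ tb.
  have := kT (aO (c s)) (aO (c t)) (aO b).
  have := kT (aO a) (aO (c s)) (aO b).
  rewrite ax bY -/T ler_norml; lra.
- have [a0 b0 F0] := hc 0 (lexx 0) T0.
  by have := ka _ _ (lexx a) a0; rewrite ax; lra.
- have [aT Tb FT] := hc T T0 (lexx T).
  by have := ka _ _ aT Tb; rewrite bY; lra.
Qed.

(** Almost geodesics with error tending to zero live in a fixed compact set,
    so they have a pointwise limit along an ultrafilter, and the metric passes
    to the limit. *)
Lemma ex_qh_geodesic x y : Omega x -> Omega y ->
  exists g, [/\ qh_geodesic Omega g (k x y), g 0 = x & g (k x y) = y].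
Proof.
move=> Ox Oy; set T := k x y; have T0 : 0 <= T := qh_dist_ge0 boundary_neq0 x y.
have e0 j : 0 < j.+1%:R^-1 :> R by rewrite invr_gt0.
have [h hh] := choice (fun j => almost_geodesic Ox Oy (e0 j)).
have [U [UU oU]] := ultraFilterLemma (eventually_filter).
have hO j t : 0 <= t -> t <= T -> Omega (h j t) by have [+ _ _ _] := hh j; exact.
pose c := delta x * expR (- (T + 1 + 1)).
have c0 : 0 < c by rewrite mulr_gt0 ?expR_gt0 ?boundary_dist_gt0.
have hc j t : 0 <= t -> t <= T -> core Omega c (h j t).
  move=> t0 tT; apply: core_of_qh_ball => //; first exact: hO.
  have [_ h1 h2 _] := hh j; have := h1 0 t (lexx 0) t0 tT.
  have j1 : j.+1%:R^-1 <= 1 :> R by rewrite invf_le1// ler1n.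
  have := kT Ox (hO j 0 (lexx 0) T0) (hO j t t0 tT).
  move: h2 j1; set e := (j.+1%:R^-1 : R) => ? ? ?; rewrite ler_norml => /andP[? ?]; clearbody e; lra.
have ex_lim t : exists u, 0 <= t -> t <= T -> Omega u /\
    forall A, nbhs u A -> U [set j | A (h j t)].
  have [/andP[t0 tT]|ht] := boolP ((0 <= t) && (t <= T)); last first.
    by exists x => t0 tT; rewrite t0 tT in ht.
  have [|u [cu hu]] := compact_core Omega_bounded boundary_neq0
      (c := c) (F := fmap (fun j => h j t) U) _.
    change (U [set j | core Omega c (h j t)]).
    by apply: filterS filterT => j _; exact: (hc j t t0 tT).
  exists u => _ _; split; first exact: (core_sub Omega_open boundary_neq0 c0 cu).
  move=> A uA; have [//|UA] := in_ultra_setVsetC (fun j => A (h j t)) UU.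
  by have [v [/= nAv Av]] := hu (~` A) A UA uA.
have [g hg] := choice ex_lim.
have gO t : 0 <= t -> t <= T -> Omega (g t) by move=> t0 tT; have [] := hg t t0 tT.
have gnear t e : 0 <= t -> t <= T -> 0 < e -> U [set j | k (g t) (h j t) < e].
  move=> t0 tT e'0; have [Og hA] := hg t t0 tT.
  by apply: (hA [set u | k (g t) u < e]); exact: qh_dist_near.
have small e : 0 < e -> U [set j | j.+1%:R^-1 < e].
  by move=> e'0; apply: oU; exact: (near_infty_natSinv_lt (PosNum e'0)).
have ggeo s t : 0 <= s -> s <= t -> t <= T -> k (g s) (g t) = t - s.
  move=> s0 st tT; have t0 := le_trans s0 st; have sT := le_trans st tT.
  suff : forall e, 0 < e -> `|k (g s) (g t) - (t - s)| <= e + e + e.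
    move=> he; apply/eqP; rewrite -subr_eq0 -normr_le0; apply/ler_addgt0Pr => e e'0.
    have := he (e / 3); rewrite divr_gt0// => /(_ isT); lra.
  move=> e e'0.
  have [j [[js jt] je]] := filter_ex
    (filterI (filterI (gnear s e s0 sT e'0) (gnear t e t0 tT e'0)) (small e e'0)).
  move: js jt je => /=; set d := j.+1%:R^-1 => js jt je.
  have [_ h1 _ _] := hh j; have := h1 s t s0 st tT; rewrite -/d; clearbody d.
  have gs := gO s s0 sT; have gt := gO t t0 tT.
  have hs := hO j s s0 sT; have ht := hO j t t0 tT.
  have := kT gs hs gt; have := kT hs ht gt; have := kT hs gs ht; have := kT gs gt ht.
  rewrite (kC hs gs) (kC ht gt) => ? ? ? ?.
  by rewrite !ler_norml => /andP[? ?]; apply/andP; split; lra.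
have eq_of_small u v : Omega u -> Omega v -> (forall e, 0 < e -> k u v <= e + e) -> u = v.
  move=> Ou Ov uv.
  have [D D0 hD] := enorm_le_qh_dist Omega_open Omega_connected Omega_bounded boundary_neq0.
  have k0 : k u v <= 0.
    by apply/ler_addgt0Pr => e e'0; have := uv (e / 2); rewrite divr_gt0// => /(_ isT); lra.
  apply/eqP; rewrite -subr_eq0; apply/eqP/enorm_eq0/eqP; rewrite eq_le enorm_ge0 andbT.
  by rewrite (le_trans (hD u v Ou Ov))// mulr_ge0_le0// ltW.
exists g; split.
- split => // [t|s t]; rewrite !in_itv/= => /andP[t0 tT]; first exact: gO.
  move=> /andP[t0' tT']; have [st|/ltW ts] := leP s t.
    by rewrite ggeo// distrC ger0_norm// subr_ge0.
  by rewrite (kC (gO s t0 tT) (gO t t0' tT')) ggeo// ger0_norm// subr_ge0.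
- apply: eq_of_small => // [|e e'0]; first exact: gO.
  have [j [j1 j2]] := filter_ex (filterI (gnear 0 e (lexx 0) T0 e'0) (small e e'0)).
  move: j1 j2 => /=; set d := j.+1%:R^-1 => j1 j2.
  have [_ _ + _] := hh j; rewrite -/d; clearbody d => h2.
  have g0 := gO 0 (lexx 0) T0; have h0 := hO j 0 (lexx 0) T0.
  have := kT g0 h0 Ox; rewrite (kC h0 Ox); lra.
- apply: eq_of_small => // [|e e'0]; first exact: gO.
  have [j [j1 j2]] := filter_ex (filterI (gnear T e T0 (lexx T) e'0) (small e e'0)).
  move: j1 j2 => /=; set d := j.+1%:R^-1 => j1 j2.
  have [_ _ _] := hh j; rewrite -/d; clearbody d => h2.
  have gT := gO T T0 (lexx T); have hT := hO j T T0 (lexx T).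
  have := kT gT hT Oy; rewrite -/T in h2; lra.
Qed.

End Geodesics.

(** * Upper limits of Gromov products *)

Section LimsupNearBoundary.
Context {R : realType} {n : nat} (Omega : set 'rV[R]_n) (o : 'rV[R]_n).
Implicit Types (p q z w : 'rV[R]_n).

(** Uniform form of the finiteness of the upper limits of Gromov products. *)
Definition gromov_bounded_near p q : Prop := exists U V (C : R),
  [/\ nbhs p U, nbhs q V & forall z w, Omega z -> Omega w -> U z -> V w ->
    gromov_product Omega o z w <= C].

Lemma gromov_bounded_limsup p q (z w : nat -> 'rV[R]_n) :
  gromov_bounded_near p q -> (forall j, Omega (z j)) -> (forall j, Omega (w j)) ->
  z @ \oo --> p -> w @ \oo --> q ->
  (limn_esup (fun j => (gromov_product Omega o (z j) (w j))%:E) < +oo)%E.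
Proof.
move=> [U [V [C [pU qV UV]]]] zO wO zp wq.
apply: (@le_lt_trans _ _ C%:E); last exact: ltry.
apply: (@le_trans _ _ (ereal_sup [set (gromov_product Omega o (z j) (w j))%:E |
    j in [set j | U (z j) /\ V (w j)]])).
  apply: ereal_inf_lbound; exists [set j | U (z j) /\ V (w j)] => //.
  exact: (filterI (zp _ pU : \oo [set j | U (z j)]) (wq _ qV : \oo [set j | V (w j)])).
by apply: ge_ereal_sup => _ [j [Uz Vw] <-]; rewrite lee_fin UV.
Qed.

(** Otherwise points chosen in balls of radius [1 / (j + 1)] with Gromov
    product larger than [j] have infinite upper limit. *)
Lemma gromov_limsup_bounded p q :
  (forall z w : nat -> 'rV[R]_n, (forall j, Omega (z j)) -> (forall j, Omega (w j)) ->
    z @ \oo --> p -> w @ \oo --> q ->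
    (limn_esup (fun j => (gromov_product Omega o (z j) (w j))%:E) < +oo)%E) ->
  gromov_bounded_near p q.
Proof.
move=> limsup; apply: contrapT => unbounded.
have e0 j : 0 < j.+1%:R^-1 :> R by rewrite invr_gt0.
have ex_zw j : exists zw : 'rV[R]_n * 'rV[R]_n, [/\ Omega zw.1, Omega zw.2,
    enorm (zw.1 - p) < j.+1%:R^-1, enorm (zw.2 - q) < j.+1%:R^-1 &
    j%:R < gromov_product Omega o zw.1 zw.2].
  apply: contrapT => no; apply: unbounded.
  exists [set z | enorm (z - p) < j.+1%:R^-1], [set w | enorm (w - q) < j.+1%:R^-1].
  exists j%:R; split; [exact: near_enorm|exact: near_enorm|].
  move=> z w Oz Ow zp wq; rewrite leNgt; apply/negP => jzw.
  by apply: no; exists (z, w).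
have [zw hzw] := choice ex_zw.
have cvg (u : nat -> 'rV[R]_n) (x : 'rV[R]_n) :
    (forall j, enorm (u j - x) < j.+1%:R^-1) -> u @ \oo --> x.
  move=> ux; apply/cvgrPdist_lt => e e'0.
  apply: filterS (near_infty_natSinv_lt (PosNum e'0)) => j /= je.
  by rewrite distrC (le_lt_trans (ler_norm_enorm _))// (lt_trans (ux j)).
have : (limn_esup (fun j => (gromov_product Omega o (zw j).1 (zw j).2)%:E) < +oo)%E.
  apply: limsup; [by move=> j; case: (hzw j)|by move=> j; case: (hzw j)| |].
    by apply: cvg => j; case: (hzw j).
  by apply: cvg => j; case: (hzw j).
move=> /ereal_inf_lt[_ [A oA <-]] supA.
suff : ereal_sup [set (gromov_product Omega o (zw j).1 (zw j).2)%:E | j in A] = +oo%E.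
  by move=> supAE; move: supA; rewrite supAE ltxx.
apply/eqyP => M M0.
have [j [Aj Mj]] := filter_ex (filterI oA (nbhs_infty_gtr M)).
apply: le_trans (_ : (j%:R)%:E <= _)%E; first by rewrite lee_fin ltW.
apply: le_trans (_ : (gromov_product Omega o (zw j).1 (zw j).2)%:E <= _)%E.
  by rewrite lee_fin ltW//; case: (hzw j).
by apply: ereal_sup_ubound; exists j.
Qed.

End LimsupNearBoundary.

(** * Visibility and Gromov products *)

Section Visibility.
Context {R : realType} {n : nat} (Omega : set 'rV[R]_n).
Hypothesis Omega_open : open Omega.
Hypothesis Omega_connected : connected Omega.
Hypothesis Omega_bounded : bounded_set Omega.
Hypothesis boundary_neq0 : boundary Omega !=set0.
Implicit Types (o p q z w x y : 'rV[R]_n).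

Local Notation delta := (boundary_dist Omega).
Local Notation k := (qh_dist Omega).

Let kC x y : Omega x -> Omega y -> k x y = k y x :=
  qh_dist_sym Omega_open Omega_connected boundary_neq0 (x := x) (y := y).
Let kT y x z : Omega x -> Omega y -> Omega z -> k x z <= k x y + k y z :=
  @qh_dist_triangle _ _ _ Omega_open Omega_connected boundary_neq0 y x z.

(** A geodesic from [z] to [w] through a point [u] of [K] gives
    [k z w = k z u + k u w], whence a Gromov product of at most [k o u]. *)
Lemma visibility_gromov_bounded o p q (U V K : set 'rV[R]_n) : Omega o ->
  nbhs p U -> nbhs q V -> compact K -> K `<=` Omega ->
  (forall (T : R) g, qh_geodesic Omega g T -> U (g 0) -> V (g T) ->
    exists2 t, t \in `[0, T] & K (g t)) ->
  gromov_bounded_near Omega o p q.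
Proof.
move=> Oo pU qV cK KO vis.
have [M KM] := qh_dist_bounded_on_compact Omega_open Omega_connected boundary_neq0
  cK KO Oo.
exists U, V, M; split=> // z w Oz Ow Uz Vw.
have [g [gg g0 gT]] := ex_qh_geodesic Omega_open Omega_connected Omega_bounded
  boundary_neq0 Oz Ow.
have [||t t0T Kgt] := vis _ g gg; [by rewrite g0|by rewrite gT|].
have Ogt := KO _ Kgt; have kgt := KM _ Kgt.
have T0 : 0 <= k z w := qh_dist_ge0 boundary_neq0 z w.
have [_ _ geo] := gg.
have e0 : 0 \in `[0, k z w] by rewrite in_itv/= lexx.
have eT : k z w \in `[0, k z w] by rewrite in_itv/= lexx T0.
move: (geo _ _ e0 t0T) (geo _ _ t0T eT); move: (t0T); rewrite in_itv/= => /andP[t0 tT].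
rewrite g0 gT sub0r normrN ger0_norm// distrC ger0_norm ?subr_ge0// => kzt ktw.
have := kT Oz Ogt Oo; have := kT Oo Ogt Ow.
rewrite (kC Ogt Oo) /gromov_product ler_pdivrMr//; lra.
Qed.

(** Geodesics are only given as isometries for [k], which dominates the
    Euclidean distance. *)
Lemma geodesic_enorm_continuous (g : R -> 'rV[R]_n) T p : qh_geodesic Omega g T ->
  {within `[0, T], continuous (fun t => enorm (g t - p))}.
Proof.
move=> [T0 gO geo].
have [D D0 hD] := enorm_le_qh_dist Omega_open Omega_connected Omega_bounded boundary_neq0.
apply/subspace_continuousP => t /= t0T; apply/cvgrPdist_lt => e e0.
have eD : 0 < e / D by rewrite divr_gt0.
rewrite near_withinE.
have : \forall s \near t, `|t - s| < e / D.
  by have := nbhsx_ballx t _ eD; rewrite -ball_normE.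
apply: filterS => s + s0T; rewrite ltr_pdivlMr// mulrC => tse.
rewrite (le_lt_trans (ler_dist_enorm _ _))// opprB addrA subrK.
by apply: le_lt_trans (hD _ _ (gO _ t0T) (gO _ s0T)) _; rewrite geo.
Qed.

(** A geodesic avoiding the compact sets [core Omega c] with [c] small passes,
    on the sphere of radius [r] around [p], close to a boundary point [u]
    different from [p] and [q]. Bounded Gromov products near [(p, u)] and
    [(u, q)] bound the distance from [o] to the passage point, which is absurd
    so close to the boundary. *)
Lemma gromov_bounded_visibility o p q : Omega o -> p <> q ->
  (forall p' q', boundary Omega p' -> boundary Omega q' -> p' <> q' ->
    gromov_bounded_near Omega o p' q') ->
  boundary Omega p -> boundary Omega q ->
  exists U V K : set 'rV[R]_n,
    [/\ nbhs p U, nbhs q V, closure U `&` closure V = set0,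
        compact K /\ K `<=` Omega &
        forall (T : R) g, qh_geodesic Omega g T -> U (g 0) -> V (g T) ->
          exists2 t, t \in `[0, T] & K (g t)].
Proof.
move=> Oo pq bounded bp bq.
pose r := enorm (q - p) / 2.
have r0 : 0 < r.
  rewrite divr_gt0// lt_def enorm_ge0 andbT; apply/eqP => /enorm_eq0/eqP.
  by rewrite subr_eq0 => /eqP/esym.
have e0 j : 0 < j.+1%:R^-1 :> R by rewrite invr_gt0.
pose m j : R := Num.min (r / 2) j.+1%:R^-1.
have m0 j : 0 < m j by rewrite lt_min e0 divr_gt0.
have mr j : m j <= r / 2 by rewrite ge_min lexx.
have mj j : m j <= j.+1%:R^-1 by rewrite ge_min lexx orbT.
pose B x (j : nat) := [set z | enorm (z - x) < m j].
have cB x j : closure (B x j) `<=` [set z | enorm (z - x) <= r / 2].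
  pose D := (fun z => enorm (z - x)) @^-1` [set s : R | s <= r / 2].
  have /closure_id DE : closed D.
    apply: preimage_closed; last exact: closed_le.
    by move=> z _; exact: enorm_sub_continuous.
  have BD : B x j `<=` D by move=> z /= /ltW zx; exact: le_trans (mr j).
  by have := closureS BD; rewrite -DE.
apply: contrapT => no.
have ex_u j : exists gT : (R -> 'rV[R]_n) * (R * R), let g := gT.1 in
    let T := gT.2.1 in let t := gT.2.2 in
    [/\ qh_geodesic Omega g T, B p j (g 0), B q j (g T), t \in `[0, T] &
        enorm (g t - p) = r /\ delta (g t) < j.+1%:R^-1].
  apply: contrapT => noj; apply: no; exists (B p j), (B q j), (core Omega j.+1%:R^-1).
  split; [exact: near_enorm|exact: near_enorm| | |].
  - apply/seteqP; split => // z [/cB/= zp /cB/= zq].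
    have := enorm_triangle z q p; rewrite (enormB q z).
    have : enorm (q - p) = r + r by rewrite /r; lra.
    lra.
  - by split; [exact: compact_core|exact: core_sub].
  move=> T g gg gp gq; apply: contrapT => avoid; apply: noj.
  have [T0 gO _] := gg.
  have [|t t0T gtr] := IVT T0 (geodesic_enorm_continuous (p := p) gg) (v := r).
    have gpr : enorm (g 0 - p) <= r.
      by move: gp (mr j); rewrite /B/=; lra.
    have gqr : r <= enorm (g T - p).
      have := enorm_triangle (g T) q p; rewrite (enormB q (g T)).
      have : enorm (q - p) = r + r by rewrite /r; lra.
      by move: gq (mr j); rewrite /B/=; lra.
    by rewrite ge_min gpr le_max gqr orbT.
  exists (g, (T, t)); split => //=; split => //.
  rewrite ltNge; apply/negP => jd; apply: avoid; exists t => //.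
  by split => //; apply: subset_closure; exact: gO.
have [gTt hgTt] := choice ex_u.
pose u j := (gTt j).1 (gTt j).2.2.
have uO j : Omega (u j) by have [[_ gO _] _ _ t0T _] := hgTt j; exact: gO.
have [|x [cx ux]] := compact_closure Omega_bounded (F := u @ \oo) _.
  change (\oo [set j | closure Omega (u j)]).
  by apply: filterS filterT => j _; exact: (subset_closure (uO j)).
have xr : enorm (x - p) = r.
  apply/eqP; rewrite -subr_eq0 -normr_le0; apply/ler_addgt0Pr => e e'0.
  have [_ [[j _ <-] /= yx]] := ux (range u) [set y | enorm (y - x) < e]
    (filterS (fun j _ => imageT u j) filterT) (near_enorm x e'0).
  have [_ _ _ _ [<- _]] := hgTt j; rewrite -/(u j) add0r.
  apply: le_trans (ler_dist_enorm _ _) _.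
  by rewrite opprB addrA subrK enormB ltW.
have small_delta e : 0 < e -> \forall j \near \oo, delta (u j) < e.
  move=> e'0; apply: filterS (near_infty_natSinv_lt (PosNum e'0)) => j /= je.
  by have [_ _ _ _ [_ du]] := hgTt j; exact: lt_trans je.
have bx : boundary Omega x.
  apply/boundary_openE => //; split => // Ox.
  have dx := boundary_dist_gt0 Omega_open boundary_neq0 Ox.
  have dx2 : 0 < delta x / 2 by rewrite divr_gt0.
  have [_ [[j /= dj <-] /= yx]] := ux (u @` [set j | delta (u j) < delta x / 2])
    [set y | enorm (y - x) < delta x / 2]
    (filterS (fun j dj => imageP u dj) (small_delta _ dx2)) (near_enorm x dx2).
  have := boundary_dist_lip boundary_neq0 x (u j); rewrite (enormB x); lra.
have px : p <> x.
  by move=> px; move: xr r0; rewrite px subrr enorm0 => <-; rewrite ltxx.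
have xq : x <> q.
  by move=> xq; move: r0 xr; rewrite xq /r; lra.
have [U1 [V1 [C1 [pU1 xV1 b1]]]] := bounded _ _ bp bx px.
have [U2 [V2 [C2 [xU2 qV2 b2]]]] := bounded _ _ bx bq xq.
pose c := delta o * expR (- (C1 + C2)).
have c0 : 0 < c.
  by rewrite mulr_gt0 ?expR_gt0//; exact: boundary_dist_gt0.
have ends (y : 'rV[R]_n) (V : set 'rV[R]_n) : nbhs y V -> \forall j \near \oo, B y j `<=` V.
  move=> /nbhs_ballP[e /= e'0 eV].
  apply: filterS (near_infty_natSinv_lt (PosNum e'0)) => j /= je z zy; apply: eV.
  rewrite -ball_normE /ball_/= distrC (le_lt_trans (ler_norm_enorm _))//.
  by rewrite (lt_trans zy)// (le_lt_trans (mj j)).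
have [_ [[j [[dj pj] qj] <-] [V1u U2u]]] := ux
  (u @` ([set j | delta (u j) < c] `&` [set j | B p j `<=` U1] `&` [set j | B q j `<=` V2]))
  (V1 `&` U2)
  (filterS (fun j hj => imageP u hj)
    (filterI (filterI (small_delta _ c0) (ends p U1 pU1)) (ends q V2 qV2)))
  (filterI xV1 xU2).
have [gg /pj Uz /qj Vw t0T _] := hgTt j.
move: gg Uz Vw t0T dj V1u U2u; rewrite /u /=.
case: (gTt j) => g [T t] /= gg Uz Vw t0T du V1u U2u {pj qj}.
have [T0 gO geo] := gg.
have s0 : 0 \in `[0, T] by rewrite in_itv/= lexx.
have eT : T \in `[0, T] by rewrite in_itv/= lexx T0.
have [Oz Ow Ou] := And3 (gO _ s0) (gO _ eT) (gO _ t0T).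
have h1 := b1 _ _ Oz Ou Uz V1u; have h2 := b2 _ _ Ou Ow U2u Vw.
suff kou : k o (g t) <= C1 + C2.
  have := core_of_qh_ball Omega_open Omega_connected boundary_neq0 Oo Ou kou.
  by rewrite /core -/c => -[_ /=]; rewrite leNgt du.
move: h1 h2 (geo _ _ s0 t0T) (geo _ _ t0T eT) (geo _ _ s0 eT) (kT Oz Oo Ow).
move: t0T; rewrite in_itv/= => /andP[t0 tT].
rewrite /gromov_product !ler_pdivrMr// (kC Ou Oo) !sub0r !normrN.
rewrite (ger0_norm t0) (ger0_norm T0) distrC ger0_norm ?subr_gs0//; lra.
Qed.

End Visibility.

Theorem theorem2p1 (R : realType) (n : nat) (Omega : set 'rV[R]_n)
    (hOmega : bounded_domain Omega) (o : 'rV[R]_n) (ho : Omega o) :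
  qh_visibility_domain Omega <->
  (forall (p q : 'rV[R]_n), boundary Omega p -> boundary Omega q -> p <> q ->
   forall z w : nat -> 'rV[R]_n,
     (forall k, Omega (z k)) -> (forall k, Omega (w k)) ->
     z @ \oo --> p -> w @ \oo --> q ->
     (limn_esup (fun k => (gromov_product Omega o (z k) (w k))%:E) < +oo)%E).
Proof.
have [[Oo Oc _] Ob] := hOmega; split.
- move=> [_ vis] p q bp bq pq z w zO wO zp wq.
  have bne : boundary Omega !=set0 by exists p.
  have [U [V [K [pU qV _ [cK KO] UVK]]]] := vis p q bp bq pq.
  apply: gromov_bounded_limsup zO wO zp wq.
  exact: (visibility_gromov_bounded Oo Oc Ob bne ho pU qV cK KO UVK).
- move=> limsup; split=> // p q bp bq pq.
  have bne : boundary Omega !=set0 by exists p.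
  apply: (gromov_bounded_visibility Oo Oc Ob bne ho pq _ bp bq) => p' q' bp' bq' pq'.
  by apply: gromov_limsup_bounded; exact: limsup.
Qed.
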